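(* Let $q$ be an odd prime power, $s \ge 2$ an integer, and let $E, F \subset \mathbb{F}_q^s$ satisfy $\#E \le \#F$ and $(\#E)(\#F) \ge (900+\log q)\,q^s$. Then \[ \#\Delta(E,F) \gg \min \left\{q, \frac{\#F}{q^{(s-1)/2}\log q} \right\}. \] For $s=2$ also the alternative lower bound \[ \#\Delta(E,F) \gg \min \left\{q, \frac{(\#E)^{1/2}\,\#F}{q\log q} \right\} \] holds.
   Context: $\mathbb{F}_q$ is the finite field with $q$ elements, $q$ odd. For $\mathbf{x}\in\mathbb{F}_q^s$ write $|\mathbf{x}|^2=\sum_{i=1}^s x_i^2 \in \mathbb{F}_q$. For $E,F\subset\mathbb{F}_q^s$, $\Delta(E,F)=\{|\mathbf{x}-\mathbf{y}|^2 : \mathbf{x}\in E,\ \mathbf{y}\in F\}\subset \mathbb{F}_q$ is the set of distances between $E$ and $F$. The notation $A \gg B$ means $A \ge cB$ for a positive constant $c$ depending only on $s$; $\log$ is the natural logarithm. *)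

(* Defs.v *)
From mathcomp Require Import all_boot all_algebra all_field.
From Stdlib Require Import Reals.

Set Implicit Arguments. Unset Strict Implicit. Unset Printing Implicit Defensive.
Import GRing.Theory.

Local Open Scope ring_scope.

Definition sqnorm (K : fieldType) (s : nat) (x : 'rV[K]_s) : K :=
  \sum_(i < s) (x 0 i) ^+ 2.

Definition dist_set (K : finFieldType) (s : nat) (E F : {set 'rV[K]_s}) : {set K} :=
  [set sqnorm (x - y) | x in E, y in F].

(* Main.v *)
Require Import Defs.
From mathcomp Require Import all_boot all_order all_algebra all_fingroup all_solvable all_field all_character.
From mathcomp Require Import ring zify.

(** Write [D = dist_set E F] and let [N t] be the number of pairs at distance [t].
    Expanding in additive characters, [N t] is the mean value [#|E| #|F| / q], plus the
    contribution of the isotropic frequencies (present only in even dimension,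
    negligible for [t <> 0] since [900 q^s <= #|E| #|F|]), plus a fluctuation whose
    second moment is at most [#|F|] times the largest L2 mass of the Fourier transform
    of [E] on a sphere of nonzero radius.  As [N 0] is at most a fixed fraction of
    [#|E| #|F|], Cauchy-Schwarz over [D] without 0 bounds [#|D|] from below.

    The L2 mass on a sphere is bounded by the Fourier decay of spheres: Salie sums
    in odd dimension, Kloosterman sums in even dimension.  For the plane the second
    bound comes instead from the fourth moment, as two distinct circles of equal
    radius meet in at most two points.  No logarithm is lost, and [log q] is only used
    through [1 <= log q].

    Weil's bound for a Kloosterman sum [k] over [F_q] is obtained from the identity
    [k' = 2q - k^2] for the sum [k'] over the quadratic extension.  If [k^2 > 4q],
    iterating makes the sums over [F_(q^(2^n))] negative and far larger than
    [q^(2^(n-1))] in absolute value, whatever the other characters contribute.  Adding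
    over all characters of [F_q] contradicts a lower bound for the number of solutions of
    [x + c/x = y^q - y], which is the upper bound of Stepanov's method for the twisted
    curve [v^2 = nu ((y^q - y)^2 - 4c)]. *)
Set Implicit Arguments. Unset Strict Implicit. Unset Printing Implicit Defensive.
Import Order.TTheory GRing.Theory Num.Theory.
Local Open Scope ring_scope.

(** * Additive characters and squares in finite fields *)

Lemma card_finField_pchar_nat (F : finFieldType) : [pchar F].-nat #|F|.
Proof.
have [p pr_p pcharFp] := finPcharP F.
have pG : p.-nat #|F| by have := pprimeChar_pgroup pcharFp; rewrite /pgroup cardsT.
by apply: sub_in_pnat pG => x _ /eqnP ->.
Qed.

Lemma card_finField_natr0 (F : finFieldType) : #|F|%:R = 0 :> F.
Proof.
have /pnatP := card_finField_pchar_nat F => /(_ (ltnW (finNzRing_gt1 _))) H.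
have /dvdnP[k ->] := pdiv_dvd #|F|.
have := H _ (pdiv_prime (finNzRing_gt1 _)) (pdiv_dvd _).
by case/andP=> _ /eqP; rewrite natrM => ->; rewrite mulr0.
Qed.

Section AddChar.
Variable F : finFieldType.

Definition addchar (psi : F -> algC) : Prop :=
  psi 0 = 1 /\ {morph psi : x y / x + y >-> x * y}.

Definition nontrivial (psi : F -> algC) : Prop := exists x, psi x != 1.

Variable psi : F -> algC.
Hypothesis psiP : addchar psi.

Lemma addchar0 : psi 0 = 1. Proof. by case: psiP. Qed.
Lemma addcharD x y : psi (x + y) = psi x * psi y. Proof. by case: psiP. Qed.

Lemma addcharMn x n : psi (x *+ n) = psi x ^+ n.
Proof.
elim: n => [|n IH]; first by rewrite mulr0n addchar0.
by rewrite mulrS addcharD IH exprS.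
Qed.

Lemma norm_addchar x : `|psi x| = 1.
Proof.
apply/eqP; rewrite -(@pexpr_eq1 _ _ #|F|) ?normr_ge0 ?(ltnW (finNzRing_gt1 _)) //.
by rewrite -normrX -addcharMn -mulr_natr card_finField_natr0 mulr0 addchar0 normr1.
Qed.

Lemma addchar_neq0 x : psi x != 0.
Proof. by rewrite -normr_eq0 norm_addchar oner_eq0. Qed.

Lemma addcharN x : psi (- x) = (psi x)^*.
Proof.
apply: (mulfI (addchar_neq0 x)).
by rewrite -addcharD subrr addchar0 -normCK norm_addchar expr1n.
Qed.

Lemma addchar_sum (I : Type) (r : seq I) (P : pred I) (G : I -> F) :
  psi (\sum_(i <- r | P i) G i) = \prod_(i <- r | P i) psi (G i).
Proof. by apply: (big_morph psi) => [x y|]; [exact: addcharD | exact: addchar0]. Qed.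

Lemma sum_addchar : nontrivial psi -> \sum_x psi x = 0.
Proof.
case=> y psi_y; apply: (mulfI (_ : 1 - psi y != 0)); first by rewrite subr_eq0 eq_sym.
rewrite mulr0 mulrBl mul1r mulr_sumr (reindex_inj (addrI y)) /=.
by apply/eqP; rewrite subr_eq0; apply/eqP/eq_bigr => x _; rewrite addcharD.
Qed.

Lemma sum_addcharM a : nontrivial psi ->
  \sum_x psi (a * x) = if a == 0 then #|F|%:R else 0.
Proof.
move=> psi_n; case: eqP => [->|/eqP a0].
  rewrite (eq_bigr (fun=> 1)) => [|x _]; last by rewrite mul0r addchar0.
  by rewrite sumr_const.
by rewrite -[RHS](sum_addchar psi_n) [RHS](reindex_inj (mulfI a0)).
Qed.

Lemma addchar_scale a : addchar (fun x => psi (a * x)).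
Proof. by split=> [|x y]; rewrite ?mulr0 ?addchar0 // mulrDr addcharD. Qed.

Lemma nontrivial_scale a : a != 0 -> nontrivial psi -> nontrivial (fun x => psi (a * x)).
Proof. by move=> a0 [x psi_x]; exists (a^-1 * x); rewrite mulVKf. Qed.

End AddChar.

(** The additive group is abelian and nontrivial, so it has a nonprincipal irreducible character,
    and that character is linear. *)
Lemma exists_addchar (F : finFieldType) : exists psi : F -> algC, addchar psi /\ nontrivial psi.
Proof.
have /has_nonprincipal_irr[i i0] : [set: F] != 1%g :> {set F} by apply: finNzRing_nontrivial.
have abF : abelian [set: F].
  by apply/centsP => x _ y _; rewrite /commute /= !FinRing.zmodMgE addrC.
have lin_i := char_abelianP _ abF i.
exists 'chi_i; split; first split.
- exact: (lin_char1 lin_i).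
- by move=> x y; have := lin_charM lin_i (in_setT x) (in_setT y); rewrite FinRing.zmodMgE.
case: (pickP (fun x => 'chi_i x != 1)) => [x ?|chi1]; first by exists x.
case/negP: i0; rewrite -(inj_eq irr_inj) irr0; apply/eqP/cfunP => x.
by rewrite cfun1E in_setT; apply/eqP/negPn; rewrite chi1.
Qed.

Section Squares.
Variable F : finFieldType.
Hypothesis oddF : odd #|F|.
Implicit Types (x y w nu : F).

Lemma two_neq0 : 2 != 0 :> F.
Proof.
apply/negP => two0.
have char2 : 2%N \in [pchar F] by apply/andP.
have F1 := finNzRing_gt1 F.
have /pnatP := card_finField_pchar_nat F => /(_ (ltnW F1)) H.
have := H _ (pdiv_prime F1) (pdiv_dvd _); rewrite (pcharf_eq char2) => /eqP pd2.
by have := pdiv_dvd #|F|; rewrite pd2 dvdn2 oddF.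
Qed.

Definition is_square w := [exists y, y ^+ 2 == w].

Lemma is_squareP w : reflect (exists y, y ^+ 2 = w) (is_square w).
Proof. by apply: (iffP existsP) => -[y /eqP]; exists y => //; apply/eqP. Qed.

Lemma eqrN_self x : (x == - x) = (x == 0).
Proof. by rewrite -addr_eq0 -mulr2n -mulr_natr mulf_eq0 (negPf two_neq0) orbF. Qed.

Lemma exists_nonsquare : exists nu, ~~ is_square nu.
Proof.
apply/existsP; rewrite -negb_forall; apply/negP => /forallP sq.
have inj : injective (fun x : F => x ^+ 2).
  suff /image_injP inj : #|image (fun x : F => x ^+ 2) F| == #|F|.
    by move=> x y; apply: inj.
  apply/eqP/eq_card => x; rewrite [RHS]inE; have /is_squareP[y <-] := sq x.
  by apply/imageP; exists y.
have /inj/eqP : 1 ^+ 2 = (- 1) ^+ 2 :> F by rewrite sqrrN.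
by rewrite eqrN_self oner_eq0.
Qed.

Lemma card_sqrt_le2 w : (#|[set y | y ^+ 2 == w]| <= 2)%N.
Proof.
have [/is_squareP[a aw]|/is_squareP nsq] := boolP (is_square w).
  apply: leq_trans (_ : #|[set a; - a]| <= 2)%N; last by rewrite cards2; case: eqP.
  by apply: subset_leq_card; apply/subsetP => y; rewrite !inE -aw eqf_sqr.
rewrite (eq_card (B := pred0)) ?card0 // => y; rewrite !inE.
by apply/eqP => yw; apply: nsq; exists y.
Qed.

Variable nu : F.
Hypothesis nuP : ~~ is_square nu.

Lemma nonsq_neq0 : nu != 0.
Proof. by apply: contra nuP => /eqP ->; apply/is_squareP; exists 0; rewrite expr0n. Qed.

(** Each of the two counts sums to [#|F|] over [w], and their sum is at most [2] for
    every [w], so it is always [2]. *)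
Lemma card_sqrt_twist w :
  (#|[set y | y ^+ 2 == w]| + #|[set y | (nu * y ^+ 2)%R == w]| = 2)%N.
Proof.
pose A w := #|[set y : F | y ^+ 2 == w]|; pose B w := #|[set y | nu * y ^+ 2 == w]|.
have BE u : B u = A (nu^-1 * u).
  apply: eq_card => y; rewrite !inE.
  by rewrite -[RHS](inj_eq (mulfI nonsq_neq0)) mulVKf // nonsq_neq0.
have AB u : (A u + B u <= 2)%N.
  have [-> | u0] := eqVneq u 0.
    rewrite BE mulr0 /A (eq_card (B := pred1 0)) ?card1 // => y.
    by rewrite !inE sqrf_eq0.
  have [/is_squareP[a au]|/is_squareP nsq] := boolP (is_square u); last first.
    rewrite /A (eq_card (B := pred0)) ?card0 ?add0n ?BE ?card_sqrt_le2 // => y.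
    by rewrite !inE; apply/eqP => yu; apply: nsq; exists y.
  rewrite [B u](_ : _ = 0%N) ?addn0 ?card_sqrt_le2 //; apply: eq_card0 => y.
  rewrite !inE; apply/negP => /eqP yu; case/is_squareP: nuP.
  exists (a / y); have y0 : y != 0.
    by apply: contraNneq u0 => y0; rewrite -yu y0 expr0n mulr0.
  by rewrite expr_div_n au -yu mulfK // expf_neq0.
have sumC (f : F -> F) : (\sum_u #|[set y | f y == u]| = #|F|)%N.
  rewrite -[RHS]cardsT -[RHS]sum1_card [RHS](partition_big f predT) //=.
  by apply: eq_bigr => u _; rewrite -sum1_card; apply: eq_bigl => y; rewrite !inE.
have : (\sum_u (A u + B u) = \sum_(u : F) 2)%N.
  by rewrite big_split /= /A /B !sumC sum_nat_const muln2 addnn.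
move/eqP; have E u : true -> (A u + B u <= 2 ?= iff (A u + B u == 2))%N.
  by move=> _; apply/leqifP; case: eqP => // /eqP ?; rewrite ltn_neqAle AB andbT.
by rewrite (leqif_sum E) => /forallP/(_ w)/eqP.
Qed.

Lemma sum_sqr_twist (g : F -> algC) :
  \sum_v (g (v ^+ 2) + g (nu * v ^+ 2)) = (\sum_w g w) *+ 2.
Proof.
have E (f : F -> F) : \sum_v g (f v) = \sum_w g w *+ #|[set y | f y == w]|.
  rewrite (partition_big f predT) //=; apply: eq_bigr => w _.
  rewrite (eq_bigr (fun=> g w)) => [|v /eqP -> //].
  by rewrite sumr_const; congr (_ *+ _); apply: eq_card => y; rewrite !inE.
rewrite big_split /= (E (fun v => v ^+ 2)) (E (fun v => nu * v ^+ 2)).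
rewrite -big_split /= -sumrMnl; apply: eq_bigr => w _.
by rewrite -mulrnDr card_sqrt_twist.
Qed.

Lemma nonsq_twist w : ~~ is_square w -> exists y, nu * y ^+ 2 = w.
Proof.
move=> nsw; have := card_sqrt_twist w.
rewrite [#|[set y | _ == w]|](_ : _ = 0%N) => [|]; last first.
  by apply: eq_card0 => y; rewrite !inE; apply: contraNF nsw => /eqP yw; apply/is_squareP; exists y.
rewrite add0n => card2; have /card_gt0P[y] : (0 < #|[set y | (nu * y ^+ 2)%R == w]|)%N by rewrite card2.
by rewrite inE => /eqP; exists y.
Qed.

Lemma fermat_finField y : y != 0 -> y ^+ #|F|.-1 = 1.
Proof.
move=> y0; apply: (mulfI y0).
by rewrite -exprS prednK ?(ltnW (finNzRing_gt1 F)) // expf_card mulr1.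
Qed.

Lemma half_predE : ((#|F|.-1)./2 * 2 = #|F|.-1)%N.
Proof.
rewrite muln2 halfK; suff -> : odd #|F|.-1 = false by rewrite subn0.
by move: oddF; rewrite -(prednK (ltnW (finNzRing_gt1 F))) /= => /negbTE.
Qed.
End Squares.

(** * The quadratic character *)

Section Legendre.
Variable F : finFieldType.
Hypothesis oddF : odd #|F|.
Implicit Types (x y w nu : F).

Lemma sqr_euler x : x != 0 -> is_square x -> x ^+ (#|F|.-1)./2 = 1.
Proof.
move=> x0 /is_squareP[a ax]; rewrite -ax -exprM mulnC half_predE // fermat_finField //.
by apply: contraNneq x0 => a0; rewrite -ax a0 expr0n.
Qed.

(** The quadratic character of [F]: [0] at [0], [1] on nonzero squares, [-1] elsewhere. *)
Definition leg w : algC := #|[set y | y ^+ 2 == w]|%:R - 1.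

Lemma card_sqrt w : #|[set y | y ^+ 2 == w]|%:R = 1 + leg w.
Proof. by rewrite /leg addrCA subrr addr0. Qed.

Lemma leg0 : leg 0 = 0.
Proof.
rewrite /leg (eq_card (B := pred1 0)) ?card1 ?subrr // => y.
by rewrite !inE sqrf_eq0.
Qed.

Lemma leg_nonsq w : ~~ is_square w -> leg w = -1.
Proof.
move=> nsw; rewrite /leg eq_card0 ?sub0r // => y.
by rewrite !inE; apply: contraNF nsw => /eqP yw; apply/is_squareP; exists y.
Qed.

Lemma leg_sqr a : a != 0 -> leg (a ^+ 2) = 1.
Proof.
move=> a0; rewrite /leg (_ : [set y | _] = [set a; - a]).
  by rewrite cards2 (eqrN_self oddF) a0 /= (natrD _ 1 1) addrK.
by apply/setP => y; rewrite !inE eqf_sqr.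
Qed.

Lemma legM_sqr a w : a != 0 -> leg (a ^+ 2 * w) = leg w.
Proof.
move=> a0; rewrite /leg -(card_imset [set y | y ^+ 2 == w] (mulfI a0)).
congr (_%:R - 1); apply: eq_card => y; rewrite !inE; apply/eqP/imsetP => [yw|[z]].
  exists (a^-1 * y); last by rewrite mulVKf.
  by rewrite inE exprMn yw exprVn mulKf // expf_neq0.
by rewrite inE => /eqP <- ->; rewrite exprMn.
Qed.

Lemma legM_nonsq nu w : ~~ is_square nu -> leg (nu * w) = - leg w.
Proof.
move=> nsnu; have [->|w0] := eqVneq w 0; first by rewrite mulr0 leg0 oppr0.
have nu0 := nonsq_neq0 nsnu.
have [/is_squareP[a aw]|nsw] := boolP (is_square w).
  have a0 : a != 0 by apply: contraNneq w0 => a0; rewrite -aw a0 expr0n.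
  by rewrite -aw mulrC legM_sqr // leg_sqr // leg_nonsq.
have [b bw] := nonsq_twist nsnu nsw.
have b0 : b != 0 by apply: contraNneq w0 => b0; rewrite -bw b0 expr0n mulr0.
rewrite (leg_nonsq nsw) -bw mulrA -expr2 -exprMn leg_sqr ?opprK //.
by rewrite mulf_neq0.
Qed.

Lemma legM x y : leg (x * y) = leg x * leg y.
Proof.
have [->|x0] := eqVneq x 0; first by rewrite mul0r leg0 mul0r.
have [/is_squareP[a ax]|nsx] := boolP (is_square x).
  have a0 : a != 0 by apply: contraNneq x0 => a0; rewrite -ax a0 expr0n.
  by rewrite -ax legM_sqr // leg_sqr // mul1r.
by rewrite legM_nonsq // (leg_nonsq nsx) mulN1r.
Qed.

Lemma sum_sqr (g : F -> algC) : \sum_v g (v ^+ 2) = \sum_w (1 + leg w) * g w.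
Proof.
rewrite (partition_big (fun v => v ^+ 2) predT) //=; apply: eq_bigr => w _.
rewrite (eq_bigr (fun=> g w)) => [|v /eqP -> //].
by rewrite sumr_const -card_sqrt mulr_natl; congr (_ *+ _); apply: eq_card => y; rewrite !inE.
Qed.

Lemma sum_leg : \sum_w leg w = 0.
Proof.
have E : \sum_(w : F) (1 + leg w) = \sum_(w : F) 1.
  by rewrite (sum_sqr (fun=> 1)); apply: eq_bigr => w _; rewrite mulr1.
by apply: (addrI (\sum_(w : F) 1)); rewrite -big_split addr0.
Qed.

Lemma norm_leg w : w != 0 -> `|leg w| = 1.
Proof.
move=> w0; have [/is_squareP[a aw]|nsw] := boolP (is_square w); last by rewrite leg_nonsq // normrN1.
have a0 : a != 0 by apply: contraNneq w0 => a0; rewrite -aw a0 expr0n.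
by rewrite -aw leg_sqr // normr1.
Qed.
End Legendre.

(** * Stepanov's bound *)

(** With more polynomials than coefficients, the coefficient matrix has a nonzero left kernel. This
    produces the auxiliary polynomial of Stepanov's method. *)
Lemma poly_lin_dep (K : fieldType) (I : finType) (v : I -> {poly K}) M :
  (forall i, size (v i) <= M)%N -> (M < #|I|)%N ->
  exists c : I -> K, (exists i, c i != 0) /\ \sum_i c i *: v i = 0.
Proof.
move=> size_v ltM; pose A := \matrix_(i < #|I|, j < M) (v (enum_val i))`_j.
have ker0 : kermx A != 0.
  by rewrite -mxrank_eq0 mxrank_ker subn_eq0 -ltnNge (leq_ltn_trans (rank_leq_col A)).
have [i rowi0] : exists i, row i (kermx A) != 0.
  by apply/existsP; rewrite -negb_forall; apply: contra ker0 => /'forall_eqP H;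
     apply/eqP/row_matrixP => i; rewrite H row0.
pose c (x : I) := row i (kermx A) 0 (enum_rank x).
exists c; split.
  have [j rij0] : exists j, row i (kermx A) 0 j != 0.
    apply/existsP; rewrite -negb_forall; apply: contra rowi0 => /'forall_eqP H.
    by apply/eqP/rowP => j; rewrite H mxE.
  by exists (enum_val j); rewrite /c enum_valK.
apply/polyP => j; rewrite coef0 coef_sum.
have [ltj|lej] := ltnP j M; last first.
  apply: big1 => x _; rewrite coefZ nth_default ?mulr0 //.
  exact: leq_trans (size_v x) lej.
have /rowP/(_ (Ordinal ltj)) : row i (kermx A) *m A = 0.
  by rewrite -row_mul mulmx_ker row0.
rewrite mxE [RHS]mxE => E; rewrite -[RHS]E {E} (reindex_onto enum_val enum_rank) /=; last by move=> x _; rewrite enum_rankK.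
apply: eq_big => [k|k _]; first by rewrite enum_valK eqxx.
by rewrite coefZ /c enum_valK [A _ _]mxE.
Qed.

(** A squarefree nonconstant [h] is not a constant times the square of a rational function: once the
    gcd is removed, the numerator [r1] divides [h] twice, so it is constant, and then [h] is
    constant too. *)
Lemma squarefree_sqr_quot (K : fieldType) (h s r : {poly K}) kappa :
  coprimep h h^`() -> (1 < size h)%N -> kappa != 0 ->
  s ^+ 2 * h = kappa *: r ^+ 2 -> s = 0 /\ r = 0.
Proof.
move=> cop_h size_h k0 E.
have h0 : h != 0 by rewrite -size_poly_gt0 (ltn_trans _ size_h).
have [s0|s0] := eqVneq s 0.
  split=> //; move/eqP: E; rewrite s0 expr0n mul0r eq_sym scaler_eq0 (negPf k0) /=.
  by rewrite expf_eq0 /= => /eqP.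
exfalso; have gcd0 : gcdp s r != 0 by rewrite gcdp_eq0 negb_and s0.
have [s1 s1E] := dvdpP _ _ (dvdp_gcdl s r).
have [r1 r1E] := dvdpP _ _ (dvdp_gcdr s r).
have cop : coprimep s1 r1.
  have := @coprimep_div_gcd _ s r; rewrite s0 /= => /(_ isT).
  by rewrite {1}s1E {3}r1E !mulpK.
have {}E : s1 ^+ 2 * h = kappa *: r1 ^+ 2.
  apply: (mulfI (expf_neq0 2 gcd0)); rewrite -scalerAr -exprMn.
  by rewrite [_ * r1]mulrC -r1E -E {2}s1E; ring.
have r1h : r1 %| h.
  rewrite -(Gauss_dvdpr _ (_ : coprimep r1 (s1 ^+ 2))); last first.
    by rewrite coprimep_sym coprimep_expl.
  by rewrite E dvdpZr // dvdp_exp.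
have [w wE] := dvdpP _ _ r1h.
have r10 : r1 != 0 by apply: contraNneq h0 => r10; rewrite wE r10 mulr0.
have {}E : s1 ^+ 2 * w = kappa *: r1.
  apply: (mulIf r10); rewrite -mulrA -wE E -scalerAl expr2.
  by [].
have r1w : r1 %| w.
  rewrite -(Gauss_dvdpr _ (_ : coprimep r1 (s1 ^+ 2))); last first.
    by rewrite coprimep_sym coprimep_expl.
  by rewrite E dvdpZr.
have r1h' : r1 %| h^`().
  by rewrite wE derivM dvdp_add ?dvdp_mulIr // dvdp_mulr.
have size_r1 : size r1 == 1.
  rewrite -dvdp1 -(eqp_dvdr _ (_ : gcdp h h^`() %= 1)) ?dvdp_gcd ?r1h ?r1h' //.
  by rewrite -size_poly_eq1.
have w1 : size w == 1.
  rewrite -dvdp1; apply: dvdp_trans (_ : r1 %| 1); last by rewrite dvdp1.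
  by rewrite -(dvdpZr _ _ k0) -E dvdp_mull.
by move: size_h; rewrite wE size_mul ?(eqP size_r1) ?(eqP w1) //;
  rewrite -size_poly_gt0 (eqP w1).
Qed.

Lemma exprn_sum_pchar (R : comNzRingType) n (I : Type) (r : seq I) (P : pred I) (f : I -> R) :
  [pchar R].-nat n ->
  (\sum_(i <- r | P i) f i) ^+ n = \sum_(i <- r | P i) f i ^+ n.
Proof.
move=> charn; apply: (big_morph (fun x => x ^+ n)) => [x y|]; first exact: exprDn_pchar.
by rewrite expr0n; case: n charn.
Qed.

Lemma pchar_nat_poly (K : fieldType) n : [pchar K].-nat n -> [pchar {poly K}].-nat n.
Proof. by apply: sub_in_pnat => p _ /(rmorph_pchar (polyC : {rmorphism K -> {poly K}})). Qed.

Section Stepanov.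
Variables (L : finFieldType) (q0 m e : nat) (h : {poly L}).
Hypothesis q0_pchar : [pchar L].-nat q0.
Hypothesis q0E : q0 = (e * 2).+1.
Hypothesis cardL : #|L| = (q0 * q0)%N.
Hypothesis size_h : size h = m.+1.
Hypothesis m_gt0 : (0 < m)%N.
Hypothesis h0 : h.[0] != 0.
Hypothesis cop_h : coprimep h h^`().
Variable B : nat.
Hypothesis leB : (m + 2 * B <= q0)%N.

(** Multiplying by [(s - r * h ^+ e) * h] gives [s ^+ 2 * h - r ^+ 2 * h ^+ q0]. Modulo ['X^q0] the
    power [h ^+ q0] is the constant [k], so [s ^+ 2 * h - k *: r ^+ 2] is divisible by ['X^q0]. Its
    degree is too small for that unless it vanishes, and [h] is squarefree. *)
Lemma stepanov_low_order (s r : {poly L}) : (size s <= B)%N -> (size r <= B)%N ->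
  'X^q0 %| s + r * h ^+ e -> s = 0 /\ r = 0.
Proof.
move=> size_s size_r dv; pose k := h.[0] ^+ q0.
apply: (@squarefree_sqr_quot _ h _ _ k cop_h); rewrite ?size_h ?expf_neq0 //.
apply/eqP; rewrite -subr_eq0; apply/negPn/negP => nz.
have hq : h ^+ q0 - k%:P = (h - h.[0]%:P) ^+ q0.
  apply/eqP; rewrite subr_eq polyC_exp -exprDn_pchar ?subrK //.
  exact: pchar_nat_poly.
have E : s ^+ 2 * h - k *: r ^+ 2 =
    (s + r * h ^+ e) * ((s - r * h ^+ e) * h) + r ^+ 2 * (h ^+ q0 - k%:P).
  have -> : h ^+ q0 = h * h ^+ e * h ^+ e by rewrite q0E exprS muln2 -addnn exprD mulrA.
  by rewrite -mul_polyC; ring.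
have : 'X^q0 %| s ^+ 2 * h - k *: r ^+ 2.
  rewrite E; apply: dvdp_add; [exact: dvdp_mulr | apply: dvdp_mull].
  rewrite hq dvdp_exp2r //.
  by rewrite -['X]subr0 -polyC0 dvdp_XsubCl rootE !hornerE subrr.
move/dvdp_leq => /(_ nz); rewrite size_polyXn leqNgt; apply/negP/negPn.
apply: leq_ltn_trans (size_polyD _ _) _; rewrite size_polyN gtn_max.
have ss (p : {poly L}) : (size p <= B)%N -> (size (p ^+ 2) <= (2 * B).-1)%N.
  by move=> size_p; apply: leq_trans (size_polyMleq _ _) _; lia.
apply/andP; split.
  apply: leq_ltn_trans (size_polyMleq _ _) _; rewrite size_h.
  move: (ss _ size_s) leB; clear; move: (size (s ^+ 2)) => z; lia.
apply: leq_ltn_trans (size_scale_leq _ _) _.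
by move: (ss _ size_r) leB; clear; move: (size (r ^+ 2)) => z; lia.
Qed.

(** Blocks are removed from the lowest order up: modulo ['X^q0] only the block [j = 0] survives, and
    once it vanishes the remaining sum can be divided by ['X^q0]. *)
Lemma stepanov_nonzero A (s r : nat -> {poly L}) :
  (forall j, size (s j) <= B)%N -> (forall j, size (r j) <= B)%N ->
  \sum_(j < A) (s j + r j * h ^+ e) * 'X^(j * q0) = 0 ->
  forall j, (j < A)%N -> s j = 0 /\ r j = 0.
Proof.
elim: A s r => [//|A IH] s r size_s size_r; rewrite big_ord_recl /= mul0n expr0 mulr1.
rewrite (eq_bigr (fun j : 'I_A => (s j.+1 + r j.+1 * h ^+ e) * 'X^(j * q0) * 'X^q0)); last first.
  by move=> j _; rewrite -mulrA -exprD /bump /= add1n mulSn addnC.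
rewrite -mulr_suml; set T := \sum_(j < A) _ => E.
have [s00 r00] : s 0%N = 0 /\ r 0%N = 0.
  apply: stepanov_low_order => //.
  by rewrite (eqP (_ : s 0%N + _ == - (T * 'X^q0))) -?addr_eq0 ?E // dvdpNr dvdp_mulIr.
have T0 : T = 0.
  apply: (mulIf (_ : 'X^q0 != 0)); first by rewrite -size_poly_gt0 size_polyXn.
  by move: E; rewrite s00 r00 mul0r !add0r mul0r.
by case=> [|j] // /(IH (fun j => s j.+1) (fun j => r j.+1)); apply.
Qed.

(** Linear algebra gives polynomials [s_j, r_j] of size at most [B], not all zero, such that
    [\sum_j (s_j^q0 * h^e + r_j^q0) * 'X^j = 0].  At a point of [L], where [x^(q0 * q0) = x],
    this is [h^e] times the [q0]-th power of
    [W = \sum_j (s_j + r_j * h^e) * 'X^(j * q0)] as soon as [h^(e * q0.+1) = 1], so all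
    the points counted are roots of [W]. *)
Lemma stepanov_card A : (B * q0 + e * m + A < 2 * (A * B))%N ->
  (#|[set x | (h.[x] ^+ (#|L|.-1)./2 == 1)%R]| <= B + e * m + A * q0)%N.
Proof.
move=> ltM.
have size_he : (size (h ^+ e) <= (e * m).+1)%N.
  by have := size_poly_exp_leq h e; rewrite size_h mulnC.
pose v (x : bool * 'I_A * 'I_B) :=
  'X^(x.2 * q0) * (if x.1.1 then 1 else h ^+ e) * 'X^(x.1.2) : {poly L}.
have size_v x : (size (v x) <= B * q0 + e * m + A)%N.
  case: x => [[b j] i]; rewrite /v /=; set hb := (if b then _ else _).
  have size_b : (size hb <= (e * m).+1)%N by rewrite /hb; case: (b); rewrite ?size_poly1.
  apply: leq_trans (size_polyMleq _ _) _; rewrite size_polyXn.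
  have := size_polyMleq ('X^(i * q0)) hb; rewrite size_polyXn.
  have : (i.+1 * q0 <= B * q0)%N by rewrite leq_mul2r ltn_ord orbT.
  move: (size ('X^(i * q0) * hb)) (size hb) (e * m)%N (ltn_ord j) size_b; rewrite mulSn.
  by move: (i * q0)%N (B * q0)%N (j : nat); clear; lia.
have [||c [[[[b0 j0] i0] c0] sum_c]] := @poly_lin_dep _ _ v (B * q0 + e * m + A).
- exact: size_v.
- by rewrite !card_prod card_bool !card_ord -mulnA.
(* The coefficients are raised to the power [q0] because [c ^+ (q0 * q0) = c] on [L]: the [q0]-th
   power of [t b j] has coefficients [c] again. The value [0] beyond [A] only serves to index by all
   of [nat]. *)
pose t b (j : nat) : {poly L} :=
  if insub j is Some j' then \sum_(i < B) c (b, j', i) ^+ q0 *: 'X^i else 0.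
have tE b (j : 'I_A) : t b j = \sum_(i < B) c (b, j, i) ^+ q0 *: 'X^i.
  by rewrite /t valK.
have size_t b j : (size (t b j) <= B)%N.
  rewrite /t; case: insub => [j'|]; last by rewrite size_poly0.
  apply: leq_trans (size_sum _ _ _) _; apply/bigmax_leqP => i _.
  by apply: leq_trans (size_scale_leq _ _) _; rewrite size_polyXn.
pose W := \sum_(j < A) (t false j + t true j * h ^+ e) * 'X^(j * q0).
have expQ (x : L) : x ^+ (q0 * q0) = x by rewrite -cardL expf_card.
have q0_gt0 : (0 < q0)%N by rewrite q0E.
have W0 : W != 0.
  apply/eqP => /(stepanov_nonzero (size_t false) (size_t true)) /(_ j0 (ltn_ord j0)) [].
  rewrite !tE => s0 r0; have : (t b0 j0)`_i0 = 0.
    by rewrite tE; case: (b0); rewrite ?s0 ?r0 coef0.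
  rewrite tE coef_sum (bigD1 i0) //= big1 => [|i ii0]; last first.
    by rewrite coefZ coefXn eq_sym (inj_eq val_inj) (negPf ii0) mulr0.
  by rewrite coefZ coefXn eqxx mulr1 addr0 => /eqP; rewrite expf_eq0 (negPf c0) andbF.
have size_W : (size W <= B + e * m + A * q0)%N.
  apply: leq_trans (size_sum _ _ _) _; apply/bigmax_leqP => j _.
  apply: leq_trans (size_polyMleq _ _) _; rewrite size_polyXn addnS /=.
  have : (size (t false j + t true j * h ^+ e)%R <= B + e * m)%N.
    apply: leq_trans (size_polyD _ _) _; rewrite geq_max (leq_trans (size_t _ _)) ?leq_addr //=.
    apply: leq_trans (size_polyMleq _ _) _; move: (size_t true j) size_he; clear; move: (size _) (size _) (e * m)%N; lia.
  have : (j * q0 <= A * q0)%N by rewrite leq_mul2r ltnW ?ltn_ord ?orbT.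
  by clear; move: (size _) (e * m)%N (j * q0)%N (A * q0)%N; lia.
rewrite cardE; apply: leq_trans size_W; apply: ltnW.
apply: max_poly_roots; rewrite ?enum_uniq //; apply/allP => x; rewrite mem_enum inE => /eqP hx1.
(* Here [#|L|.-1 = 2 * e * q0.+1], so the exponent in [hx1] is [e + e * q0]. *)
have he2 : h.[x] ^+ e * h.[x] ^+ (e * q0) = 1.
  rewrite -exprD -[RHS]hx1; congr (_ ^+ _); rewrite cardL q0E.
  by rewrite (_ : _.-1 = (e + e * (e * 2).+1).*2)%N ?doubleK //; clear; lia.
have hx0 : h.[x] ^+ e != 0.
  by apply/eqP => z; move: he2; rewrite z mul0r => /eqP; rewrite eq_sym oner_eq0.
suff : h.[x] ^+ e * W.[x] ^+ q0 = 0.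
  by move/eqP; rewrite mulf_eq0 (negPf hx0) expf_eq0 q0_gt0.
have tx b j : (t b j).[x] ^+ q0 =
    if insub j is Some j' then \sum_(i < B) c (b, j', i) * x ^+ (i * q0) else 0.
  rewrite /t; case: insub => [j'|]; last by rewrite horner0 expr0n -leqn0 leqNgt q0_gt0.
  rewrite horner_sum exprn_sum_pchar //; apply: eq_bigr => i _.
  by rewrite hornerZ hornerXn exprMn -!exprM expQ.
transitivity ((\sum_x0 c x0 *: v x0).[x]); last by rewrite sum_c horner0.
rewrite horner_sum; transitivity (\sum_b \sum_j \sum_i (c (b, j, i) *: v (b, j, i)).[x]); last first.
  by rewrite horner_sum pair_bigA /= pair_bigA /=; apply: eq_bigr => -[[b j] i].
rewrite big_bool /= -big_split /= exprn_sum_pchar // mulr_sumr.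
apply: eq_bigr => j _.
rewrite !hornerE exprMn exprDn_pchar // exprMn -exprM !tx valK.
have -> : \sum_(i < B) (c (true, j, i) *: v (true, j, i)).[x] =
    (\sum_(i < B) c (true, j, i) * x ^+ (i * q0)) * x ^+ j.
  by rewrite mulr_suml; apply: eq_bigr => i _; rewrite /v /= mulr1 !hornerE.
have -> : \sum_(i < B) (c (false, j, i) *: v (false, j, i)).[x] =
    (\sum_(i < B) c (false, j, i) * x ^+ (i * q0)) * (h.[x] ^+ e * x ^+ j).
  by rewrite mulr_suml; apply: eq_bigr => i _; rewrite /v /= !hornerE; ring.
have -> : (x ^+ (j * q0)) ^+ q0 = x ^+ j.
  by rewrite -exprM -mulnA mulnC exprM expQ.
rewrite mulrA mulrDr mulrCA he2; ring.
Qed.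

End Stepanov.

(** * Kloosterman sums and quadratic extensions *)

(** Used to deduce one equation from another: [ring] or [field] checks that the differences of the
    two sides agree. *)
Lemma eq_from_subr (V : zmodType) (a b c d : V) : a - b = c - d -> c = d -> a = b.
Proof. by move=> E cd; apply/eqP; rewrite -subr_eq0 E cd subrr. Qed.

Lemma quadratic_extension (F : finFieldType) (nu : F) : ~~ is_square nu ->
  exists (L : finFieldType) (iota : {rmorphism F -> L}) (theta : L),
    #|L| = (#|F| * #|F|)%N /\ theta ^+ 2 = iota nu.
Proof.
move=> nsnu; pose p : {poly F} := 'X^2 - nu%:P.
have size_p : size p = 3 by rewrite /p size_XnsubC.
have mi : monic_irreducible_poly p.
  split; last by rewrite monicXnsubC.
  apply: cubic_irreducible; rewrite ?size_p // => x.
  rewrite rootE !hornerE subr_eq0; apply: contra nsnu => xnu.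
  by apply/existsP; exists x.
pose L := {poly %/ p with mi}.
exists L, (GRing.in_alg L), (in_qpoly p 'X); split.
  by rewrite card_qfpoly size_p /= expnS expn1.
have pp0 : in_qpoly p p = 0 :> {poly %/ p}.
  apply/val_inj; rewrite /= [X in Pdiv.CommonRing.rmodp _ X](_ : _ = p); last first.
    by rewrite mk_monicE.
  by rewrite Pdiv.RingMonic.rmodpp ?monicXnsubC.
have : in_qpoly p ('X ^+ 2) = in_qpoly p (p + nu *: 1) :> {poly %/ p}.
  by rewrite /p -alg_polyC subrK.
by rewrite in_qpolyD pp0 add0r in_qpolyZ in_qpoly1 expr2 in_qpolyM.
Qed.

Definition Kl (F : finFieldType) (psi : F -> algC) (c : F) : algC :=
  \sum_(x | x != 0) psi (x + c / x).

Section Doubling.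
Variables (F : finFieldType) (nu : F) (L : finFieldType) (iota : {rmorphism F -> L}) (theta : L).
Hypothesis oddF : odd #|F|.
Hypothesis nsnu : ~~ is_square nu.
Hypothesis cardL : #|L| = (#|F| * #|F|)%N.
Hypothesis theta2 : theta ^+ 2 = iota nu.

Definition pair_ext (p : F * F) : L := iota p.1 + iota p.2 * theta.

Lemma pair_ext_inj : injective pair_ext.
Proof.
move=> [u v] [u' v']; rewrite /pair_ext /= => E.
have {}E : iota (u - u') = iota (v' - v) * theta.
  by apply: (eq_from_subr _ E); rewrite !rmorphB; ring.
have [vv'|vv'] := eqVneq (v' - v) 0.
  move/eqP: (vv'); rewrite subr_eq0 => /eqP ->.
  move/eqP: E; rewrite vv' rmorph0 mul0r fmorph_eq0 subr_eq0 => /eqP -> //.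
case/negP: nsnu; apply/is_squareP; exists ((u - u') / (v' - v)); apply: (fmorph_inj iota).
rewrite rmorphXn rmorphM fmorphV E mulrC mulKf ?theta2 //.
by rewrite fmorph_eq0.
Qed.

Lemma pair_ext_bij : bijective pair_ext.
Proof. by apply: (inj_card_bij pair_ext_inj); rewrite cardL card_prod. Qed.

Definition ext_fst (x : L) : F :=
  if [pick p | pair_ext p == x] is Some p then p.1 else 0.

Lemma ext_fstE p : ext_fst (pair_ext p) = p.1.
Proof.
rewrite /ext_fst; case: pickP => [p' /eqP/pair_ext_inj -> //|/(_ p)].
by rewrite eqxx.
Qed.

(** The trace of the extension: the conjugate of [u + v * theta] is [u - v * theta], so the trace is
    [2 * u]. *)
Definition ext_tr (x : L) : F := 2 * ext_fst x.

Lemma ext_trD : {morph ext_tr : x y / x + y}.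
Proof.
have [dec _ decK] := pair_ext_bij.
move=> x y; rewrite -(decK x) -(decK y).
move: (dec x) (dec y) => [u v] [u' v'].
have -> : pair_ext (u, v) + pair_ext (u', v') = pair_ext (u + u', v + v').
  by rewrite /pair_ext /= !rmorphD; ring.
by rewrite /ext_tr !ext_fstE mulrDr.
Qed.

Lemma ext_trZ a x : ext_tr (iota a * x) = a * ext_tr x.
Proof.
have [dec _ decK] := pair_ext_bij; rewrite -(decK x); move: (dec x) => [u v].
have -> : iota a * pair_ext (u, v) = pair_ext (a * u, a * v).
  by rewrite /pair_ext /= !rmorphM; ring.
by rewrite /ext_tr !ext_fstE mulrCA.
Qed.

Lemma ext_tr1 : ext_tr 1 = 2.
Proof.
have -> : 1 = pair_ext (1, 0) by rewrite /pair_ext rmorph1 rmorph0 mul0r addr0.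
by rewrite /ext_tr ext_fstE mulr1.
Qed.

(** For odd [n] the power [theta ^+ n] is a multiple of [theta] by an element of the base field, so
    Frobenius preserves the two coordinate lines. *)
Lemma ext_tr_frob n x : odd n -> [pchar F].-nat n -> ext_tr (x ^+ n) = ext_tr x ^+ n.
Proof.
move=> oddn charn; have [dec _ decK] := pair_ext_bij; rewrite -(decK x); move: (dec x) => [u v].
have charLn : [pchar L].-nat n.
  by apply: sub_in_pnat charn => p _ /(rmorph_pchar iota).
have -> : pair_ext (u, v) ^+ n = pair_ext (u ^+ n, v ^+ n * nu ^+ n./2).
  rewrite /pair_ext /= exprDn_pchar // exprMn rmorphM !rmorphXn -theta2 -exprM.
  have nE : n = (n./2.*2).+1 by rewrite -[LHS](odd_double_half n) oddn.
  by rewrite mul2n -mulrA -exprSr -nE.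
rewrite /ext_tr !ext_fstE exprMn; congr (_ * _).
by rewrite (natrD _ 1 1) exprDn_pchar // expr1n.
Qed.

Section KloostermanDoubling.
Variables (psi : F -> algC) (c : F).
Hypothesis psiP : addchar psi.
Hypothesis psi_n : nontrivial psi.
Hypothesis c0 : c != 0.

(** The summand at an element of trace [2 * u] and norm [u ^+ 2 - w]: as [c / x] is the conjugate of
    [x] times [c] over the norm, the trace of [x + c / x] depends only on trace and norm. Norm zero
    is excluded from the sum. *)
Let g u w : algC := if u ^+ 2 == w then 0 else psi (2 * (1 + c / (u ^+ 2 - w)) * u).

Lemma Kl_ext : Kl (psi \o ext_tr) (iota c) = \sum_u \sum_v g u (nu * v ^+ 2).
Proof.
rewrite pair_bigA /= /Kl big_mkcond /= (reindex pair_ext); last exact: onW_bij pair_ext_bij.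
apply: eq_bigr => -[u v] _ /=; rewrite /g.
pose N := u ^+ 2 - nu * v ^+ 2.
have NE : pair_ext (u, v) * pair_ext (u, - v) = iota N.
  by rewrite /pair_ext /N /= rmorphB (rmorphM iota nu) -theta2; ring.
have N0 : (pair_ext (u, v) != 0) = (u ^+ 2 != nu * v ^+ 2).
  congr (~~ _); rewrite -[RHS]subr_eq0 -(fmorph_eq0 iota) -/N -NE mulf_eq0.
  have E w : (pair_ext (u, w) == 0) = ((u, w) == (0, 0)).
    rewrite -(inj_eq pair_ext_inj); congr (_ == _).
    by rewrite /pair_ext /= !rmorph0 mul0r addr0.
  by rewrite !E !xpair_eqE oppr_eq0 orbb.
rewrite N0; case: eqP => //= /eqP nz.
have {}nz : N != 0 by rewrite subr_eq0.
congr psi.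
have -> : iota c / pair_ext (u, v) = iota (c / N) * pair_ext (u, - v).
  have x0 : pair_ext (u, v) != 0 by rewrite N0 -subr_eq0.
  apply: (mulIf x0); rewrite divfK // -mulrA [_ * pair_ext (u, v)]mulrC NE.
  by rewrite -rmorphM divfK.
rewrite ext_trD ext_trZ /ext_tr !ext_fstE /=; rewrite -/N; ring.
Qed.

(** The split counterpart of [Kl_ext]: a pair of variables is written as [(u + v, u - v)], with
    [u ^+ 2 - v ^+ 2] as norm. *)
Lemma Kl_sqr : Kl psi c ^+ 2 = \sum_u \sum_v g u (v ^+ 2).
Proof.
have h2 := two_neq0 oddF.
pose f (p : F * F) := (p.1 + p.2, p.1 - p.2).
have f_bij : bijective f.
  by exists (fun p : F * F => ((p.1 + p.2) / 2, (p.1 - p.2) / 2)) => -[x y]; rewrite /f /=; congr (_, _); field.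
rewrite pair_bigA /= /Kl expr2 big_distrlr /= pair_big big_mkcond (reindex f) /=; last exact: onW_bij.
apply: eq_bigr => -[u v] _; rewrite /f /g /=.
rewrite eqf_sqr -(subr_eq0 u v) -(addr_eq0 u v).
have [//|x0] := eqVneq (u + v) 0; first by rewrite orbT.
have [//|y0] := eqVneq (u - v) 0.
by rewrite /= -addcharD //; congr psi; field; rewrite subr_sqr mulf_eq0 negb_or x0 y0.
Qed.

(** For fixed [u] the norms [u^2 - nu v^2] of the extension and the norms [u^2 - v^2] of [F * F]
    together cover every element of [F] twice. *)
Lemma Kl_doubling :
  Kl (psi \o ext_tr) (iota c) = #|F|%:R *+ 2 - Kl psi c ^+ 2.
Proof.
have h2 := two_neq0 oddF.
apply/eqP; rewrite eq_sym subr_eq eq_sym Kl_ext Kl_sqr -big_split /=; apply/eqP.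
rewrite (eq_bigr (fun u => (\sum_w g u w) *+ 2)) => [|u _]; last first.
  by rewrite addrC -big_split -(sum_sqr_twist nsnu).
rewrite sumrMnl; congr (_ *+ 2); rewrite exchange_big /=.
(* The substitution [z = u ^+ 2 - w] makes the argument linear in [u]; orthogonality then leaves
   only [z = - c], where [1 + c / z] vanishes. *)
transitivity (\sum_u \sum_z (if z == 0 then 0 else psi (2 * (1 + c / z) * u))).
  rewrite exchange_big; apply: eq_bigr => u _.
  rewrite (reindex (fun z => u ^+ 2 - z)) /=.
    apply: eq_bigr => w _; rewrite /g.
    rewrite (_ : (u ^+ 2 == u ^+ 2 - w) = (w == 0)).
      by rewrite (_ : u ^+ 2 - (u ^+ 2 - w) = w) // opprB addrC subrK.
    by rewrite -[LHS]subr_eq0 opprB addrC subrK.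
  by apply: onW_bij; exists (fun z => u ^+ 2 - z) => z; rewrite opprB addrC subrK.
rewrite exchange_big /=.
transitivity (\sum_(z | z != 0) \sum_u psi (2 * (1 + c / z) * u)).
  rewrite [RHS]big_mkcond; apply: eq_bigr => z _; case: eqP => //= _.
  by rewrite big1.
rewrite (bigD1 (- c)) ?oppr_eq0 //= [X in _ + X]big1 => [|z /andP[z0 zc]].
  by rewrite addr0 sum_addcharM // invrN mulrN divff // subrr mulr0 eqxx.
rewrite sum_addcharM // mulf_eq0 (negPf h2) /=.
have -> // : (1 + c / z == 0) = false.
apply/negbTE; apply: contra zc => /eqP E; rewrite -addr_eq0.
have -> : z + c = z * (1 + c / z) by field.
by rewrite E mulr0.
Qed.
End KloostermanDoubling.

End Doubling.

(** The recursion satisfied by Kloosterman sums over the fields with [q ^ (2 ^ k)] elements. *)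
Fixpoint Kl_tower (q k : nat) (z : algC) : algC :=
  if k is k'.+1 then (q ^ (2 ^ k'))%:R *+ 2 - Kl_tower q k' z ^+ 2 else z.

(** Quadratic extensions are stacked, [T] being the composite of the traces; at each stage
    [Kl_doubling] is applied to the character [psi \o T] of the field below. *)
Lemma tower (K : finFieldType) k : odd #|K| ->
  exists (L : finFieldType) (iota : {rmorphism K -> L}) (T : L -> K),
    [/\ #|L| = (#|K| ^ (2 ^ k))%N,
        {morph T : x y / x + y},
        (forall a x, T (iota a * x) = a * T x) /\ (exists x, T x != 0),
        (forall x, T (x ^+ #|K|) = T x) &
        forall psi c, addchar psi -> nontrivial psi -> c != 0 ->
          Kl (psi \o T) (iota c) = Kl_tower #|K| k (Kl psi c)].
Proof.
move=> oddK; elim: k => [|k [L [iota [T [cardL TD [TZ [x0 Tx0]] Tf TKl]]]]].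
  exists K, (GRing.RMorphism.clone _ _ idfun _), id; split=> //; first by split=> //; exists 1; rewrite oner_eq0.
  by move=> x; rewrite expf_card.
have oddL : odd #|L| by rewrite cardL oddX oddK orbT.
have [nu nsnu] := exists_nonsquare oddL.
have [M [iota' [theta [cardM theta2]]]] := quadratic_extension nsnu.
pose T' := ext_tr iota' theta.
exists M, (GRing.RMorphism.clone _ _ (iota' \o iota) _), (T \o T'); split => /=.
- by rewrite cardM cardL -expnD expnS mul2n addnn.
- by move=> x y; rewrite /= /T' (ext_trD nsnu cardM theta2) TD.
- split=> [a x|]; first by rewrite /T' (ext_trZ nsnu cardM theta2) TZ.
  exists (iota' (x0 / 2)); rewrite -[iota' _]mulr1 /T' (ext_trZ nsnu cardM theta2).
  by rewrite (ext_tr1 nsnu theta2) divfK // two_neq0.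
- move=> x; rewrite /T' (ext_tr_frob nsnu cardM theta2) //.
  apply: sub_in_pnat (card_finField_pchar_nat K) => p _ /(rmorph_pchar iota); exact.
move=> psi c psiP psi_n c0; rewrite -TKl // -cardL.
rewrite -(Kl_doubling oddL nsnu cardM theta2) ?fmorph_eq0 //.
- have T0 : T 0 = 0 by rewrite -[in LHS](mulr0 (iota 0)) TZ mul0r.
  by split=> [|x y]; rewrite /= ?T0 ?addchar0 // TD addcharD.
- by case: psi_n => y psi_y; exists (iota (y / T x0) * x0); rewrite /= TZ divfK.
Qed.

(** [T] plays the role of the trace from [L] to [K], and the prefix [AS] refers to the
    Artin-Schreier equation [y ^+ q - y = x + iota c / x], whose discriminant in [x] is [f y]. *)
Section WeilCount.
Variables (K L : finFieldType) (iota : {rmorphism K -> L}) (T : L -> K) (q0 : nat) (c : K).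
Hypothesis oddK : odd #|K|.
Hypothesis cardL : #|L| = (q0 * q0)%N.
Hypothesis q0_pow : exists n, q0 = (#|K| ^ n)%N.
Hypothesis q0_big : ((#|K|.+1 ^ 2).*2.+1 < q0)%N.
Hypothesis TD : {morph T : x y / x + y}.
Hypothesis TZ : forall a x, T (iota a * x) = a * T x.
Hypothesis Tf : forall x, T (x ^+ #|K|) = T x.
Hypothesis c0 : c != 0.

Let q := #|K|.
Let f (y : L) := (y ^+ q - y) ^+ 2 - 4 * iota c.

Let h0 : {poly L} := ('X^q - 'X) ^+ 2 - (4 * iota c)%:P.

Let q1 : (1 < q)%N. Proof. exact: finNzRing_gt1. Qed.

Let oddq0 : odd q0.
Proof. by have [n ->] := q0_pow; rewrite oddX oddK orbT. Qed.

Let oddL : odd #|L|. Proof. by rewrite cardL oddM oddq0. Qed.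

Let h0E y : h0.[y] = f y. Proof. by rewrite /h0 /f !hornerE. Qed.

Let size_u : size ('X^q - 'X : {poly L}) = q.+1.
Proof. by rewrite size_polyDl size_polyXn // size_polyN size_polyX ltnS. Qed.

Let size_h0 : size h0 = (2 * q).+1.
Proof.
have size_u2 : size (('X^q - 'X : {poly L}) ^+ 2) = (2 * q).+1.
  by rewrite expr2 size_mul -?size_poly_gt0 size_u // addSn addnS mul2n addnn.
by rewrite size_polyDl size_u2 // size_polyN (leq_ltn_trans (size_polyC_leq1 _)) //; lia.
Qed.

Lemma AS_root_card u : (#|[set y : L | (y ^+ q - y == u)%R]| <= q)%N.
Proof.
have size_p : size ('X^q - 'X - u%:P : {poly L}) = q.+1.
  by rewrite size_polyDl size_u // size_polyN (leq_ltn_trans (size_polyC_leq1 _)) // ltnS ltnW.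
rewrite -ltnS -size_p cardE; apply: max_poly_roots; rewrite ?enum_uniq //.
  by rewrite -size_poly_gt0 size_p.
by apply/allP => y; rewrite mem_enum inE => /eqP yu; rewrite rootE !hornerE yu subrr.
Qed.

Lemma AS_zero_card : (#|[set y | (f y == 0)%R]| <= 2 * q)%N.
Proof.
rewrite -ltnS -size_h0 cardE; apply: max_poly_roots; rewrite ?enum_uniq //.
  by rewrite -size_poly_gt0 size_h0.
by apply/allP => y; rewrite mem_enum inE rootE h0E.
Qed.

(** Where [f y] is not a square, [nu * f y] is a nonzero square, so Euler's criterion puts [y] among
    the points counted by [stepanov_card] for [nu *: h0]. *)
Lemma AS_nonsq_card : (#|[set y | ~~ is_square (f y)]| * 2 <= q0 * q0 + (4 * q + 4) * q0)%N.
Proof.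
have [n q0E] := q0_pow.
have [nu nsnu] := exists_nonsquare oddL.
have nu0 := nonsq_neq0 nsnu.
pose h := nu *: h0.
have qL : q%:R = 0 :> L by rewrite -(rmorph_nat iota) card_finField_natr0 rmorph0.
have ch4 : 4 * iota c != 0.
  have -> : 4 = 2 * 2 :> L by rewrite -natrM.
  by rewrite !mulf_neq0 ?two_neq0 // fmorph_eq0.
have size_h : size h = (2 * q).+1 by rewrite size_scale.
have hE y : h.[y] = nu * f y by rewrite /h hornerZ h0E.
have du : ('X^q - 'X : {poly L})^`() = -1.
  by rewrite derivB derivXn derivX -scaler_nat qL scale0r sub0r.
(* The derivative of ['X^q - 'X] is [-1], so that of [h0] is [-2] times ['X^q - 'X], and [h0] is a
   nonzero constant modulo ['X^q - 'X]. *)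
have cop : coprimep h h^`().
  have dh0 : h0^`() = (- 2) *: ('X^q - 'X).
    by rewrite /h0 derivB derivC subr0 expr2 derivM du scaleNr scaler_nat mulr2n; ring.
  rewrite /h derivZ coprimepZl // coprimepZr // dh0 coprimepZr ?oppr_eq0 ?two_neq0 //.
  rewrite /h0 coprimep_sym expr2 -polyCN coprimep_addl_mul -alg_polyC.
  by rewrite coprimepZr ?oppr_eq0 ?coprimep1.
(* [B] is the largest value with [2 * q + 2 * B <= q0]. For this [A], the inequality [ltM] below
   reduces to [q.+1 ^ 2 < e], which is exactly [q0_big]. *)
pose e := q0./2; pose B := (e - q)%N; pose A := (e + q + 2)%N.
have q0e : q0 = (e * 2).+1 by rewrite -[LHS](odd_double_half q0) oddq0 muln2.
have lte : (q.+1 ^ 2 < e)%N.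
  by move: q0_big; rewrite -/q {1}q0e; move: (e) (q.+1 ^ 2)%N; clear; lia.
have leqe : (q <= e)%N by move: lte; rewrite -mulnn; clear; move: (e) (q); nia.
have charq0 : [pchar L].-nat q0.
  rewrite q0E pnatX; apply/orP; left.
  by apply: sub_in_pnat (card_finField_pchar_nat K) => p _ /(rmorph_pchar iota).
have h00 : h.[0] != 0.
  by rewrite hE /f expr0n -/q (gtn_eqF (ltnW q1)) subr0 expr0n sub0r mulf_neq0 ?oppr_eq0.
have leB : (2 * q + 2 * B <= q0)%N by rewrite q0e /B; move: leqe; clear; move: (e) (q); lia.
have ltM : (B * q0 + e * (2 * q) + A < 2 * (A * B))%N.
  rewrite /A -[e](subnK leqe) -/B q0e -[e](subnK leqe) -/B.
  have : (q.+1 ^ 2 < B + q)%N by rewrite /B subnK.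
  by rewrite -mulnn; move: (B) (q); clear => b n; nia.
have SE : (#|[set y | ~~ is_square (f y)]| <= #|[set x | (h.[x] ^+ (#|L|.-1)./2 == 1)%R]|)%N.
  apply: subset_leq_card; apply/subsetP => y; rewrite !inE hE => nsf.
  apply/eqP/(sqr_euler oddL); first by rewrite mulf_neq0 // nonsq_neq0.
  have [b <-] := nonsq_twist nsnu nsf; apply/is_squareP; exists (nu * b); rewrite exprMn; ring.
have := leq_trans SE (stepanov_card charq0 q0e cardL size_h _ h00 cop leB ltM).
have q2 : (0 < 2 * q)%N by rewrite muln_gt0 (ltnW q1).
move/(_ q2) => H; apply: leq_trans (leq_mul H (leqnn 2)) _.
rewrite /A -[e](subnK leqe) -/B q0e -[e](subnK leqe) -/B.
by move: (B) (q); clear => b n; nia.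
Qed.

(** Solutions [(x, y)] of [x + iota c / x = y ^+ q - y] are counted twice. By [Tf] every such [x]
    satisfies the trace condition and has at most [q] partners [y]; conversely each [y] with [f y] a
    nonzero square yields two roots [x]. By [AS_nonsq_card] nonsquares take little more than half of
    the field. *)
Lemma AS_count :
  (q0 * q0 <= q * #|[set x : L | ((x != 0) && (T (x + iota c / x) == 0))%R]| + (4 * q + 4) * q0 + 4 * q)%N.
Proof.
set X := [set x : L | _].
pose P := [set p : L * L | (p.1 != 0) && (p.1 + iota c / p.1 == p.2 ^+ q - p.2)].
pose G := [set y | is_square (f y) && (f y != 0)].
have TN x : T (- x) = - T x by rewrite -mulN1r -(rmorphN1 iota) TZ mulN1r.
have leP : (#|P| <= q * #|X|)%N.
  rewrite -sum1_card (partition_big fst (mem X)) /=; last first.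
    move=> [x y]; rewrite !inE /= => /andP[-> /eqP ->].
    by rewrite TD TN Tf subrr eqxx.
  rewrite mulnC -sum_nat_const; apply: leq_sum => x _; rewrite sum1_card.
  apply: leq_trans (AS_root_card (x + iota c / x)).
  rewrite -(card_imset [set y : L | _] (_ : injective (pair x))); last by move=> y y' [].
  apply: subset_leq_card; apply/subsetP => -[x' y];  rewrite -topredE /= inE /= => /andP[/andP[_ /eqP E] /eqP xx'].
  by apply/imsetP; exists y; rewrite ?inE -?xx' ?E.
have geP : (2 * #|G| <= #|P|)%N.
  rewrite -[#|P|]sum1_card (partition_big snd predT) //= mulnC -sum_nat_const.
  rewrite [X in (_ <= X)%N](bigID (mem G)) /=; apply: leq_trans (leq_addr _ _); apply: leq_sum => y.
  rewrite inE => /andP[/is_squareP[w wE] fy0]; rewrite sum1_card.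
  have w0 : w != 0 by apply: contraNneq fy0 => w0; rewrite -wE w0 expr0n.
  have h2 := two_neq0 oddL.
  have h4 : 4 != 0 :> L by rewrite (natrM _ 2 2) mulf_neq0.
  pose u := y ^+ q - y.
  have E (v : L) : v ^+ 2 = f y -> ((u + v) / 2) * ((u - v) / 2) = iota c.
    move=> vE; have -> : iota c = (u ^+ 2 - f y) / 4.
      by rewrite /f -/u; field.
    by rewrite -vE; field; rewrite h4 h2.
  have inP (v : L) : v ^+ 2 = f y -> ((u + v) / 2, y) \in P.
    move=> /E vE; rewrite inE /= -/u -vE.
    have a0 : (u + v) / 2 != 0.
      by apply/eqP => a0; move: vE; rewrite a0 mul0r => /esym/eqP; rewrite fmorph_eq0 (negPf c0).
    by rewrite a0 [X in _ + X]mulrAC divff // mul1r /=; apply/eqP; field.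
  have := cards2 ((u + w) / 2, y) ((u - w) / 2, y).
  have -> : ((u + w) / 2, y) != ((u - w) / 2, y).
    rewrite xpair_eqE eqxx andbT (inj_eq (mulIf _)) ?invr_eq0 // (inj_eq (addrI _)).
    by rewrite eqrN_self.
  move=> <-; apply: subset_leq_card; apply/subsetP => p; rewrite in_set2 -topredE /=.
  case/orP => /eqP -> /=; rewrite eqxx andbT; first exact: inP.
  by have := inP (- w); rewrite sqrrN; apply.
have cover : (q0 * q0 <= #|G| + #|[set y | ~~ is_square (f y)]| + #|[set y | (f y == 0)%R]|)%N.
  rewrite -cardL -cardsT; apply: leq_trans (leq_trans (leq_card_setU _ _) (leq_add (leq_card_setU _ _) (leqnn _))).
  by apply: subset_leq_card; apply/subsetP => y _; rewrite !inE; case: is_square; case: eqP.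
move: AS_nonsq_card AS_zero_card leP geP cover; clear.
move: #|P| #|G| #|X| #|[set y | ~~ is_square (f y)]| #|[set y | (f y == 0)%R]| => a b d g i.
move: q => n; nia.
Qed.
End WeilCount.

(** Dividing [- Kl_tower] by the square root of the field size turns the recursion into
    [b |-> b^2 - 2], which preserves [-2 <= b] and escapes to infinity from every [b > 2]. *)
Definition dickson k (b : algC) : algC := iter k (fun b => b ^+ 2 - 2) b.

Lemma Kl_towerE q k z : (0 < q)%N ->
  Kl_tower q k.+1 z = - (q ^ (2 ^ k))%:R * dickson k (z ^+ 2 / q%:R - 2).
Proof.
move=> q0; have qn0 : q%:R != 0 :> algC by rewrite pnatr_eq0 -lt0n.
elim: k => [|k IH]; first by rewrite /= expn1; field.
rewrite [LHS]/= -/(Kl_tower q k.+1 z) IH /dickson iterS -/(dickson _ _).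
by rewrite (expnS 2) mul2n -addnn expnD natrM; ring.
Qed.

Lemma dickson_ge k b : b \is Num.real -> -2 <= b -> -2 <= dickson k b.
Proof.
move=> bR b2; suff [] : -2 <= dickson k b /\ dickson k b \is Num.real by [].
elim: k => //= k [IH IHR]; split; last by rewrite rpredB ?rpredX ?rpred_nat.
by rewrite -subr_ge0 opprK subrK real_exprn_even_ge0.
Qed.

(** Squaring and subtracting [2] at least quadruples the excess over [2]. Growth linear in [k]
    suffices, because the sum it must exceed in [Kl_weil] is bounded independently of [k]. *)
Lemma dickson_growth k d : 0 <= d -> 2 + k.+1%:R * d <= dickson k (2 + d).
Proof.
move=> d0; elim: k => [|k IH]; first by rewrite mul1r.
rewrite /= -/(dickson k (2 + d)).
have kd : 0 <= k.+1%:R * d by rewrite mulr_ge0 ?ler0n.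
have H : (2 + k.+1%:R * d) ^+ 2 <= dickson k (2 + d) ^+ 2.
  by apply: lerXn2r; rewrite ?nnegrE ?addr_ge0 ?ler0n ?(le_trans _ IH) ?addr_ge0 ?ler0n.
apply: le_trans (lerB H (lexx 2)).
rewrite -subr_ge0 (_ : _ - _ = (k.+1%:R * d) ^+ 2 + 3%:R * k%:R * d + 2 * d).
  by rewrite !addr_ge0 ?exprn_ge0 ?mulr_ge0 ?ler0n.
by rewrite -[k.+2]addn2 -[k.+1]addn1 !natrD; ring.
Qed.

(** * Weil's bound for Kloosterman sums *)

Lemma Kl_real (F : finFieldType) (psi : F -> algC) c : addchar psi -> Kl psi c \is Num.real.
Proof.
move=> psiP; apply/CrealP; rewrite /Kl rmorph_sum (reindex_inj oppr_inj) /=.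
apply: eq_big => x; first by rewrite oppr_eq0.
by move=> _; rewrite -addcharN // invrN mulrN -opprD opprK.
Qed.

Theorem Kl_weil (K : finFieldType) (psi : K -> algC) c :
  odd #|K| -> addchar psi -> nontrivial psi -> c != 0 -> Kl psi c ^+ 2 <= 4 * #|K|%:R.
Proof.
move=> oddK psiP psi_n c0; pose q := #|K|.
have q1 : (1 < q)%N := finNzRing_gt1 K.
have qn0 : 0 < q%:R :> algC by rewrite ltr0n ltnW.
pose z (l : K) := Kl (fun x => psi (l * x)) c.
have zR l : z l \is Num.real by apply: Kl_real; apply: addchar_scale.
pose b l := z l ^+ 2 / q%:R - 2.
have bR l : b l \is Num.real by rewrite rpredB ?rpred_div ?rpredX ?rpred_nat.
have b_ge l : -2 <= b l.
  by rewrite -subr_ge0 opprK subrK divr_ge0 ?ler0n // real_exprn_even_ge0.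
(* The condition [T (x + iota c / x) = 0] is expanded in the characters indexed by [l]: [l = 0]
   gives the number of nonzero elements, every other [l] a tower value. [AS_count] then bounds the
   sum of these values, uniformly in [k]. *)
have bound k : ((#|K|.+1 ^ 2).*2.+1 < #|K| ^ (2 ^ k))%N ->
    \sum_(l | l != 0) dickson k (b l) <= (8 * q + 4)%:R.
  move=> big; have [L [iota [T [cardL TD [TZ _] Tf TKl]]]] := tower k.+1 oddK.
  pose q0 := (q ^ (2 ^ k))%N.
  have cardL2 : #|L| = (q0 * q0)%N by rewrite cardL expnS mul2n -addnn expnD.
  have cnt := AS_count oddK cardL2 (ex_intro _ (2 ^ k)%N erefl) big TD TZ Tf c0.
  set M := #|_| in cnt.
  have T0 : T 0 = 0 by rewrite -[in LHS](mulr0 (iota 0)) TZ mul0r.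
  have E : q%:R * M%:R = (q0 * q0)%:R - 1 - q0%:R * \sum_(l | l != 0) dickson k (b l) :> algC.
    transitivity (\sum_l Kl (fun x => psi (l * T x)) (iota c)).
      rewrite /Kl exchange_big /=.
      under eq_bigr do under eq_bigr do rewrite mulrC.
      transitivity (\sum_(x : L | x != 0) if T (x + iota c / x) == 0 then q%:R else 0 : algC).
        rewrite -big_mkcondr /= sumr_const mulr_natr; congr (_ *+ _).
        by apply: eq_card => x; rewrite !inE.
      by apply: eq_bigr => x _; rewrite sum_addcharM.
    rewrite (bigD1 0) //=; congr (_ + _).
      rewrite /Kl (eq_bigr (fun=> 1)) => [|x _]; last by rewrite mul0r addchar0.
      by rewrite sumr_const -cardL2 cardC1 -subn1 natrB ?(ltnW (finNzRing_gt1 L)).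
    rewrite mulr_sumr -sumrN; apply: eq_bigr => l l0.
    have psil : addchar (fun x => psi (l * x)) by apply: addchar_scale.
    have := TKl _ c psil (nontrivial_scale l0 psi_n) c0.
    by rewrite (Kl_towerE _ _ (ltnW q1)) mulNr.
  have q00 : 0 < q0%:R :> algC by rewrite ltr0n expn_gt0 ltnW.
  rewrite -(ler_pM2l q00).
  have -> : q0%:R * \sum_(l | l != 0) dickson k (b l) = (q0 * q0)%:R - 1 - (q * M)%:R.
    by rewrite (natrM _ q M) E opprB addrC subrK.
  rewrite -natrM !lerBlDr -natrD natr1 ler_nat.
  have q0n : (0 < q0)%N by rewrite expn_gt0 ltnW.
  by apply: leq_trans cnt _; rewrite -/q; move: (q) (q0) (M) q0n; clear => n m N; nia.
rewrite real_leNgt ?rpredX ?Kl_real ?rpredM ?rpred_nat //; apply/negP => big.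
pose d := b 1 - 2.
have d0 : 0 < d.
  rewrite /d /b -addrA -opprD subr_gt0 ltr_pdivlMr // /z (_ : Kl _ _ = Kl psi c) -?natrD //.
  by apply: eq_bigr => x _; rewrite mul1r.
(* This is the [8 * q + 4] of [bound] plus [2 * q], since the other characters number at most [q]
   and contribute at least [-2] each. *)
pose C : algC := (10 * q + 4)%:R.
have C0 : 0 <= C / d by rewrite divr_ge0 ?ler0n // ltW.
(* The first summand makes [k * d] exceed [C]; the second makes the field large enough for
   [bound]. *)
pose k := (Num.bound (C / d) + (q.+1 ^ 2).*2.+1)%N.
have big_k : ((#|K|.+1 ^ 2).*2.+1 < #|K| ^ (2 ^ k))%N.
  apply: leq_ltn_trans (leq_addl (Num.bound (C / d)) _) _.
  by apply: ltn_trans (ltn_expl k (ltnSn 1)) _; apply: ltn_expl.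
have := bound k big_k; rewrite (bigD1 1) ?oner_neq0 //= => H.
have rest : - (2 * q)%:R <= \sum_(l | (l != 0) && (l != 1)) dickson k (b l).
  have : \sum_(l : K | (l != 0) && (l != 1)) (- 2) <= \sum_(l | (l != 0) && (l != 1)) dickson k (b l).
    by apply: ler_sum => l _; apply: dickson_ge.
  apply: le_trans; rewrite sumr_const mulNrn lerN2 -mulrnA ler_nat leq_mul2l /=.
  exact: max_card.
have b1E : 2 + d = b 1 by rewrite /d addrC subrK.
have := dickson_growth k (ltW d0); rewrite b1E => gr.
have : k.+1%:R * d <= C.
  have := lerD gr rest; move/le_trans => /(_ _ H) {}H.
  have -> : C = (8 * q + 4)%:R + (2 * q)%:R by rewrite -natrD; congr _%:R; clear; move: q => n; lia.
  rewrite -lerBlDr; apply: le_trans H.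
  by rewrite lerD2r lerDr ler0n.
have dR : d \is Num.real by rewrite realE (ltW d0).
apply/negP; rewrite -real_ltNge ?rpredM ?rpred_nat //.
rewrite -ltr_pdivrMr //; apply: lt_le_trans (archi_boundP C0) _.
by rewrite ler_nat /k leqW // leq_addr.
Qed.

(** * Gauss and Salie sums *)

Section Gauss.
Variables (K : finFieldType) (psi : K -> algC).
Hypothesis oddK : odd #|K|.
Hypothesis psiP : addchar psi.
Hypothesis psi_n : nontrivial psi.

Let q : algC := #|K|%:R.
Let h2 : 2 != 0 :> K. Proof. exact: two_neq0. Qed.
Let q_gt0 : 0 < q. Proof. by rewrite ltr0n (ltnW (finNzRing_gt1 K)). Qed.

Definition rtq : algC := sqrtC #|K|%:R.

Lemma rtq_ge0 : 0 <= rtq. Proof. by rewrite sqrtC_ge0 ler0n. Qed.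
Lemma rtq_gt0 : 0 < rtq. Proof. by rewrite sqrtC_gt0 q_gt0. Qed.
Lemma sqr_rtq : rtq ^+ 2 = #|K|%:R. Proof. exact: sqrtCK. Qed.

Definition gauss (k : K) : algC := \sum_x psi (k * x ^+ 2).

Lemma norm_gauss k : k != 0 -> `|gauss k| = rtq.
Proof.
move=> k0; apply/eqP; rewrite -(@eqrXn2 _ 2) ?normr_ge0 ?rtq_ge0 // sqr_rtq normCK.
rewrite /gauss rmorph_sum big_distrlr /= exchange_big /=.
under eq_bigr => y _ do rewrite (reindex_inj (addrI y)) /=.
rewrite exchange_big /=.
rewrite (eq_bigr (fun x => psi (k * x ^+ 2) * \sum_y psi (2 * k * x * y))) => [|x _]; last first.
  rewrite mulr_sumr; apply: eq_bigr => y _.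
  by rewrite -addcharN // -!addcharD //; congr psi; ring.
rewrite (bigD1 0) //= [X in _ + X]big1 => [|x x0].
  by rewrite sum_addcharM // mulr0 eqxx expr0n mulr0 addchar0 // mul1r addr0.
by rewrite sum_addcharM // !mulf_eq0 (negPf h2) (negPf k0) (negPf x0) mulr0.
Qed.

Lemma sum_leg_psi a : a != 0 -> \sum_x leg x * psi (a * x) = gauss a.
Proof.
move=> a0; rewrite /gauss (sum_sqr (fun w => psi (a * w))).
rewrite [RHS](eq_bigr (fun w => psi (a * w) + leg w * psi (a * w))) => [|w _]; last by rewrite mulrDl mul1r.
by rewrite big_split /= sum_addcharM // (negPf a0) add0r.
Qed.

Lemma leg_leg (a : K) : a != 0 -> leg a * leg a = 1 :> algC.
Proof. by move=> a0; rewrite -legM // -expr2 leg_sqr. Qed.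

Lemma leg1 : @leg K 1 = 1.
Proof. by have := leg_sqr oddK (oner_neq0 K); rewrite expr1n. Qed.

Lemma legV (a : K) : leg a^-1 = leg a.
Proof.
have [->|a0] := eqVneq a 0; first by rewrite invr0.
by rewrite -[LHS]mulr1 -(leg_leg a0) mulrA -legM // mulVf // leg1 mul1r.
Qed.

Lemma gauss_leg k : k != 0 -> gauss k = leg k * gauss 1.
Proof.
move=> k0; rewrite -!sum_leg_psi ?oner_neq0 // mulr_sumr.
rewrite [RHS](reindex_inj (mulfI k0)) /=; apply: eq_bigr => x _.
by rewrite legM // !mulrA leg_leg // !mul1r.
Qed.

Lemma sum_quadratic k z : k != 0 ->
  \sum_u psi (k * u ^+ 2 + z * u) = gauss k * psi (- z ^+ 2 / (4 * k)).
Proof.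
move=> k0; have h4 : 4 != 0 :> K by rewrite (natrM _ 2 2) mulf_neq0.
rewrite (reindex_inj (addIr (- z / (2 * k)))) /= /gauss mulr_suml.
apply: eq_bigr => u _; rewrite -addcharD //; congr psi; field.
by rewrite h4 h2 k0.
Qed.

(** The equation [j + j^-1 = u] is quadratic in [j] with discriminant [u ^+ 2 - 4], and
    [v = 2 * j - u] runs through the square roots of that discriminant. *)
Lemma sum_joukowsky (g : K -> algC) :
  \sum_(j | j != 0) g (j + j^-1) = \sum_u (1 + leg (u ^+ 2 - 4)) * g u.
Proof.
rewrite (partition_big (fun j => j + j^-1) predT) //=; apply: eq_bigr => u _.
rewrite (eq_bigr (fun=> g u)) => [|j /andP[_ /eqP -> //]].
rewrite -card_sqrt mulr_natl sumr_const; congr (_ *+ _).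
have inj : injective (fun j : K => 2 * j - u) by move=> x y /addIr /(mulfI h2).
rewrite -(card_imset _ inj); apply: eq_card => v; rewrite !inE; apply/imsetP/eqP => [[j]|vE].
  rewrite -topredE /= => /andP[j0 /eqP <-] ->; field; exact: j0.
exists ((v + u) / 2); last by field.
have h4 : 4 != 0 :> K by rewrite (natrM _ 2 2) mulf_neq0.
have E : (v + u) / 2 * (u - (v + u) / 2) = 1.
  have -> : (v + u) / 2 * (u - (v + u) / 2) = (u ^+ 2 - v ^+ 2) / 4 by field; rewrite h4 h2.
  by rewrite vE; field.
have j0 : (v + u) / 2 != 0.
  by apply/eqP => j0; move/eqP: E; rewrite j0 mul0r eq_sym oner_eq0.
have aV : ((v + u) / 2)^-1 = u - (v + u) / 2 by apply: (mulfI j0); rewrite mulfV // E.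
by rewrite -topredE /= j0 aV addrC subrK eqxx.
Qed.

(** If [u = j + j^-1] then [(u + 2) * j = (j + 1)^2], so [leg j = leg (u + 2)] unless [j = -1]. *)
Lemma salie_square e : e != 0 ->
  \sum_(j | j != 0) leg j * psi (e * (j + j^-1)) =
  \sum_u leg (u + 2) * psi (e * u) + \sum_u leg (u - 2) * psi (e * u).
Proof.
move=> e0; have n1 : -1 != 0 :> K by rewrite oppr_eq0 oner_neq0.
pose S := \sum_(j : K | j != 0) leg (j + j^-1 + 2) * psi (e * (j + j^-1)).
have S1 : S = \sum_(j | j != 0) leg j * psi (e * (j + j^-1)) - leg (-1 : K) * psi (e * (- 2)).
  rewrite /S [in RHS](bigD1 (-1)) //= (bigD1 (-1)) //=.
  have m11 : -1 + (-1)^-1 = -2 :> K by rewrite invrN1; ring.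
  rewrite m11 addNr leg0 mul0r add0r [RHS]addrAC subrr add0r; apply: eq_bigr => j /andP[j0 j1].
  congr (_ * _); rewrite -[LHS]mulr1 -(leg_leg j0) mulrA -legM //.
  have -> : (j + j^-1 + 2) * j = (j + 1) ^+ 2 by field.
  by rewrite leg_sqr ?mul1r // addr_eq0.
have S2 : S = \sum_u leg (u + 2) * psi (e * u) + \sum_u leg (u - 2) * psi (e * u)
     - leg (- 4 : K) * psi (e * (- 2)).
  rewrite /S (sum_joukowsky (fun u => leg (u + 2) * psi (e * u))).
  rewrite (eq_bigr (fun u => leg (u + 2) * psi (e * u) + leg (u ^+ 2 - 4) * (leg (u + 2) * psi (e * u))));
    last by move=> u _; rewrite mulrDl mul1r.
  rewrite big_split /= -addrA; congr (_ + _).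
  rewrite (bigD1 (- 2)) //= addNr leg0 mul0r mulr0 add0r [in RHS](bigD1 (- 2)) //=.
  have -> : - 2 - 2 = - 4 :> K by ring.
  rewrite [RHS]addrAC subrr add0r; apply: eq_bigr => u u2; rewrite mulrA; congr (_ * _).
  have -> : u ^+ 2 - 4 = (u - 2) * (u + 2) by ring.
  by rewrite legM // -mulrA leg_leg ?mulr1 // addr_eq0.
have l4 : leg (- 4 : K) = leg (-1 : K).
  have -> : - 4 = 2 ^+ 2 * (-1) :> K by ring.
  by rewrite legM_sqr.
by move: S2; rewrite S1 l4 => /addIr.
Qed.

(** If [a] or [b] is zero, what remains is a Gauss sum or the sum of [leg]. If [a * b = e ^+ 2],
    scaling by [e / a] leads to [salie_square], two shifted Gauss sums. If [a * b] is not a square,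
    the map sending [k] to [b / (a * k)] changes the sign of the sum, which is therefore zero. *)
Lemma salie_bound a b : `|\sum_(k | k != 0) leg k * psi (a * k + b / k)| <= 2 * rtq.
Proof.
have rt2 : rtq <= 2 * rtq by rewrite mulr_natl mulr2n lerDl rtq_ge0.
have lin c : `|\sum_(k | k != 0) leg k * psi (c * k)| <= 2 * rtq.
  have -> : \sum_(k | k != 0) leg k * psi (c * k) = \sum_k leg k * psi (c * k).
    by rewrite [RHS](bigD1 0) //= leg0 mul0r add0r.
  have [->|c0] := eqVneq c 0; last by rewrite sum_leg_psi // norm_gauss.
  rewrite (eq_bigr (fun k => leg k)) => [|k _]; last by rewrite mul0r addchar0 // mulr1.
  by rewrite sum_leg normr0 mulr_ge0 ?ler0n ?rtq_ge0.
have [->|b0] := eqVneq b 0.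
  rewrite (eq_bigr (fun k => leg k * psi (a * k))) ?lin // => k _.
  by rewrite mul0r addr0.
have [->|a0] := eqVneq a 0.
  rewrite (reindex_inj invr_inj) /=.
  rewrite (eq_big (fun k => k != 0) (fun k => leg k * psi (b * k))) ?lin // => k; first by rewrite invr_eq0.
  by move=> _; rewrite mul0r add0r invrK legV.
have [/is_squareP[e eE]|nsab] := boolP (is_square (a * b)).
  have e0 : e != 0.
    by apply/eqP => e0; move/eqP: eE; rewrite e0 expr0n eq_sym mulf_eq0 (negPf a0) (negPf b0).
  have ea0 : e / a != 0 by rewrite mulf_neq0 ?invr_eq0.
  rewrite (reindex_inj (mulfI ea0)) /=.
  have -> : \sum_(k | e / a * k != 0) leg (e / a * k) * psi (a * (e / a * k) + b / (e / a * k)) =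
      leg (e / a) * \sum_(j | j != 0) leg j * psi (e * (j + j^-1)).
    rewrite mulr_sumr; apply: eq_big => k; first by rewrite mulf_eq0 (negPf ea0).
    rewrite mulf_eq0 (negPf ea0) /= => k0; rewrite legM // -mulrA; congr (_ * (_ * psi _)).
    have -> : b = e ^+ 2 / a by rewrite eE mulrC mulKf.
    by field; rewrite a0 e0 k0.
  rewrite normrM norm_leg // mul1r salie_square //.
  apply: le_trans (ler_normD _ _) _; rewrite mulr_natl mulr2n.
  have shift d : `|\sum_u leg (u + d) * psi (e * u)| <= rtq.
    rewrite (reindex_inj (addIr (- d))) /=.
    rewrite (eq_bigr (fun u => leg u * psi (e * u) * psi (e * - d))) => [|u _].
      by rewrite -mulr_suml normrM norm_addchar // mulr1 sum_leg_psi // norm_gauss.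
    by rewrite subrK mulrDr addcharD // mulrA.
  by rewrite lerD // shift.
set S := \sum_(k | _) _; suff -> : S = 0 by rewrite normr0 mulr_ge0 ?ler0n ?rtq_ge0.
suff : S = - S by move/eqP; rewrite -addr_eq0 -mulr2n mulrn_eq0 => /eqP.
have ba0 : (a / b) != 0 by rewrite mulf_neq0 ?invr_eq0.
rewrite {1}/S (reindex_inj invr_inj) /= (reindex_inj (mulfI ba0)) /=.
rewrite /S -sumrN; apply: eq_big => k; first by rewrite invr_eq0 mulf_eq0 (negPf ba0).
rewrite invr_eq0 mulf_eq0 (negPf ba0) /= => k0.
rewrite legV legM // -mulNr; congr (_ * psi _); last by field; rewrite a0 b0 k0.
have -> : a / b = (b^-1) ^+ 2 * (a * b) by field.
by rewrite legM_sqr ?invr_eq0 // leg_nonsq // mulN1r.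
Qed.
End Gauss.

(** * Fourier analysis of the distance counting function *)

Section CauchySchwarz.
Variables (I : finType) (P : pred I).

(** The product of [S] with [S * V - U ^+ 2] is the sum of the squares of [S * y i - U * x i]; the
    case [S = 0] is separate. *)
Lemma real_CS (x y : I -> algC) :
  (forall i, x i \is Num.real) -> (forall i, y i \is Num.real) ->
  (\sum_(i | P i) x i * y i) ^+ 2 <= (\sum_(i | P i) x i ^+ 2) * (\sum_(i | P i) y i ^+ 2).
Proof.
move=> xR yR; set U := \sum_(i | P i) x i * y i; set S := \sum_(i | P i) x i ^+ 2.
set V := \sum_(i | P i) y i ^+ 2.
have sq_ge0 (z : algC) : z \is Num.real -> 0 <= z ^+ 2 by move=> zR; rewrite real_exprn_even_ge0.
have S0 : 0 <= S by apply: sumr_ge0 => i _; apply: sq_ge0.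
have SR : S \is Num.real by apply: ger0_real.
have UR : U \is Num.real by apply: rpred_sum => i _; rewrite rpredM.
have [Sz|Sn] := eqVneq S 0.
  have x0 i : P i -> x i = 0.
    move=> Pi; apply/eqP; rewrite -sqrf_eq0; apply/eqP.
    by apply: (psumr_eq0P _ Sz Pi) => j _; apply: sq_ge0.
  by rewrite Sz mul0r [U]big1 ?expr0n // => i /x0 ->; rewrite mul0r.
have Sp : 0 < S by rewrite lt_def Sn.
rewrite -subr_ge0 -(pmulr_rge0 _ Sp).
have -> : S * (S * V - U ^+ 2) = \sum_(i | P i) (S * y i - U * x i) ^+ 2.
  rewrite (eq_bigr (fun i => S ^+ 2 * y i ^+ 2 - 2 * S * U * (x i * y i) + U ^+ 2 * x i ^+ 2)); last first.
    by move=> i _; ring.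
  rewrite big_split sumrB /= -!mulr_sumr -/S -/U -/V; ring.
by apply: sumr_ge0 => i _; apply: sq_ge0; rewrite rpredB ?rpredM.
Qed.

Lemma CS (x y : I -> algC) :
  `|\sum_(i | P i) x i * y i| ^+ 2 <=
  (\sum_(i | P i) `|x i| ^+ 2) * (\sum_(i | P i) `|y i| ^+ 2).
Proof.
apply: le_trans (real_CS (fun i => normr_real (x i)) (fun i => normr_real (y i))).
rewrite lerXn2r ?nnegrE ?normr_ge0 ?sumr_ge0 // => [i _|]; first by rewrite mulr_ge0.
by apply: le_trans (ler_norm_sum _ _ _) _; apply: ler_sum => i _; rewrite normrM.
Qed.
End CauchySchwarz.

Section Fourier.
Variables (K : finFieldType) (psi : K -> algC).
Hypothesis oddK : odd #|K|.
Hypothesis psiP : addchar psi.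
Hypothesis psi_n : nontrivial psi.
Local Notation q := (#|K|%:R : algC).
Local Notation w := (rtq K).
Local Notation G := (gauss psi).

Lemma rtq_ge1 : 1 <= w.
Proof.
rewrite -(@ler_pXn2r _ 2) ?nnegrE ?rtq_ge0 ?ler01 // expr1n sqr_rtq ler1n.
exact: ltnW (finNzRing_gt1 K).
Qed.

(** Scaling [k] by [a^-1] gives [Kl psi (a * b)]. Weil's bound covers [b != 0], and for [b = 0] the
    sum is [-1]. *)
Lemma kloosterman_bound a b : a != 0 ->
  `|\sum_(k | k != 0) psi (a * k + b / k)| <= 2 * w.
Proof.
move=> a0; have ai0 : a^-1 != 0 by rewrite invr_eq0.
have -> : \sum_(k | k != 0) psi (a * k + b / k) = Kl psi (a * b).
  rewrite /Kl (reindex_inj (mulfI ai0)) /=.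
  apply: eq_big => k; first by rewrite mulf_eq0 (negPf ai0).
  by rewrite mulf_eq0 (negPf ai0) /= => k0; congr psi; field; rewrite a0 k0.
have [ab0|ab0] := eqVneq (a * b) 0.
  have -> : Kl psi (a * b) = -1.
    have := sum_addchar psiP psi_n; rewrite (bigD1 0) //= addchar0 // => /eqP.
    rewrite addrC addr_eq0 => /eqP <-; apply: eq_bigr => x _.
    by rewrite ab0 mul0r addr0.
  by rewrite normrN1 (le_trans rtq_ge1) // mulr_natl mulr2n lerDl rtq_ge0.
rewrite -(@ler_pXn2r _ 2) ?nnegrE ?normr_ge0 ?mulr_ge0 ?ler0n ?rtq_ge0 //.
rewrite real_normK ?Kl_real // exprMn sqr_rtq -natrX.
exact: Kl_weil.
Qed.

Lemma parseval1 (c : K -> algC) :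
  \sum_t `|\sum_l c l * psi (l * t)| ^+ 2 = q * \sum_l `|c l| ^+ 2.
Proof.
under eq_bigr => t _ do rewrite normCK rmorph_sum big_distrlr /=.
rewrite exchange_big mulr_sumr; apply: eq_bigr => l _.
rewrite exchange_big /= (bigD1 l) //= [X in _ + X]big1 => [|l' l'l].
  rewrite addr0 (eq_bigr (fun=> `|c l| ^+ 2)) => [|t _].
    by rewrite sumr_const mulr_natl.
  by rewrite rmorphM /= mulrACA -!normCK (norm_addchar psiP) expr1n mulr1.
rewrite (eq_bigr (fun t => c l * (c l')^* * psi ((l - l') * t))) => [|t _].
  by rewrite -mulr_sumr sum_addcharM // subr_eq0 eq_sym (negPf l'l) mulr0.
by rewrite rmorphM /= mulrACA -(addcharN psiP) -(addcharD psiP) -mulrBl.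
Qed.

Section Dimension.
Variable s : nat.
Local Notation V := 'rV[K]_s.

Definition dot (x y : V) : K := \sum_i x 0 i * y 0 i.

Lemma dotC x y : dot x y = dot y x.
Proof. by apply: eq_bigr => i _; rewrite mulrC. Qed.
Lemma dotBl x y z : dot (x - y) z = dot x z - dot y z.
Proof. by rewrite -sumrB; apply: eq_bigr => i _; rewrite !mxE mulrBl. Qed.
Lemma dotDr x y z : dot z (x + y) = dot z x + dot z y.
Proof. by rewrite -big_split; apply: eq_bigr => i _; rewrite !mxE mulrDr. Qed.

Lemma sum_rV_prod (f : 'I_s -> K -> algC) :
  \sum_(x : V) \prod_i f i (x 0 i) = \prod_i \sum_u f i u.
Proof.
rewrite bigA_distr_bigA /=.
rewrite (reindex (fun g : {ffun 'I_s -> K} => \row_i g i)) /=.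
  by apply: eq_bigr => g _; apply: eq_bigr => i _; rewrite mxE.
apply: onW_bij; exists (fun x : V => [ffun i => x 0 i]).
  by move=> g; apply/ffunP => i; rewrite ffunE mxE.
by move=> x; apply/rowP => i; rewrite mxE ffunE.
Qed.

Lemma sum_quadratic_rV k (z : V) : k != 0 ->
  \sum_m psi (k * sqnorm m + dot z m) = G k ^+ s * psi (- sqnorm z / (4 * k)).
Proof.
move=> k0; transitivity (\sum_(m : V) \prod_i psi (k * m 0 i ^+ 2 + z 0 i * m 0 i)).
  by apply: eq_bigr => m _; rewrite -addchar_sum // big_split -mulr_sumr.
rewrite (sum_rV_prod (fun i u => psi (k * u ^+ 2 + z 0 i * u))).
rewrite (eq_bigr (fun i => G k * psi (- z 0 i ^+ 2 / (4 * k)))) => [|i _]; last exact: sum_quadratic.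
rewrite big_split /= prodr_const card_ord; congr (_ * _).
by rewrite -addchar_sum // /sqnorm -mulr_suml sumrN.
Qed.

Lemma sum_psi_rV (z : V) : \sum_m psi (dot z m) = if z == 0 then q ^+ s else 0.
Proof.
transitivity (\sum_(m : V) \prod_i psi (z 0 i * m 0 i)).
  by apply: eq_bigr => m _; rewrite -addchar_sum.
rewrite (sum_rV_prod (fun i u => psi (z 0 i * u))).
rewrite (eq_bigr (fun i => if z 0 i == 0 then q else 0)) => [|i _]; last exact: sum_addcharM.
case: eqP => [->|/eqP z0].
  rewrite (eq_bigr (fun=> q)) => [|i _]; last by rewrite mxE eqxx.
  by rewrite prodr_const card_ord.
have [i zi] : exists i, z 0 i != 0.
  apply/existsP; apply: contraNT z0; rewrite negb_exists => /forallP z0.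
  by apply/eqP/rowP => i; rewrite mxE; apply/eqP; have := z0 i; rewrite negbK.
by rewrite (bigD1 i) //= (negPf zi) mul0r.
Qed.

Lemma parseval_rV (c : V -> algC) :
  \sum_x `|\sum_z c z * psi (dot z x)| ^+ 2 = q ^+ s * \sum_z `|c z| ^+ 2.
Proof.
under eq_bigr => x _ do rewrite normCK rmorph_sum big_distrlr /=.
rewrite exchange_big mulr_sumr; apply: eq_bigr => z _.
rewrite exchange_big /=.
have E z' : \sum_x c z * psi (dot z x) * (c z' * psi (dot z' x))^* =
    c z * (c z')^* * (if z' == z then q ^+ s else 0).
  rewrite eq_sym -subr_eq0 -sum_psi_rV mulr_sumr; apply: eq_bigr => x _.
  by rewrite rmorphM /= mulrACA -(addcharN psiP) -(addcharD psiP) -dotBl.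
rewrite (bigD1 z) //= [X in _ + X]big1 => [|z' z'z]; last by rewrite E (negPf z'z) mulr0.
by rewrite addr0 E eqxx mulrC normCK.
Qed.

Definition hat (E : {set V}) (m : V) : algC := \sum_(x in E) psi (dot x m).

Lemma hat_conj E m : (hat E m)^* = \sum_(x in E) psi (- dot x m).
Proof. by rewrite rmorph_sum; apply: eq_bigr => x _; rewrite /= -addcharN. Qed.

Lemma parseval (E : {set V}) : \sum_m `|hat E m| ^+ 2 = q ^+ s * #|E|%:R.
Proof.
pose c x : algC := (x \in E)%:R.
rewrite (eq_bigr (fun m => `|\sum_x c x * psi (dot x m)| ^+ 2)) => [|m _]; last first.
  rewrite /hat big_mkcond; congr (`|_| ^+ 2); apply: eq_bigr => x _.
  by rewrite /c; case: (x \in E); rewrite ?mul1r ?mul0r.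
rewrite parseval_rV -sum1_card natr_sum [in RHS]big_mkcond; congr (_ * _).
by apply: eq_bigr => x _; rewrite /c; case: (x \in E); rewrite ?normr1 ?expr1n ?normr0 ?expr0n.
Qed.
End Dimension.
End Fourier.

(** * Spherical transforms and the expansion of the counting function *)

Section Distances.
Variables (K : finFieldType) (psi : K -> algC) (s : nat).
Hypothesis oddK : odd #|K|.
Hypothesis psiP : addchar psi.
Hypothesis psi_n : nontrivial psi.
Local Notation q := (#|K|%:R : algC).
Local Notation w := (rtq K).
Local Notation G := (gauss psi).
Local Notation V := 'rV[K]_s.
Local Notation hat := (hat psi).

Let h2 : 2 != 0 :> K. Proof. exact: two_neq0. Qed.
Let h4 : 4 != 0 :> K. Proof. by rewrite (natrM _ 2 2) mulf_neq0. Qed.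
Let q_gt0 : 0 < q. Proof. by rewrite ltr0n (ltnW (finNzRing_gt1 K)). Qed.

Lemma gauss_neq0 k : k != 0 -> G k != 0.
Proof. by move=> k0; rewrite -normr_eq0 norm_gauss // gt_eqF // rtq_gt0. Qed.

Lemma norm_gauss_sqr k : k != 0 -> `|G k ^+ s| ^+ 2 = q ^+ s.
Proof. by move=> k0; rewrite normrX norm_gauss // exprAC sqr_rtq. Qed.

(** Even powers of the quadratic character are [1] at nonzero points. The parity of [s] thus decides
    whether Salie or Kloosterman sums appear. *)
Lemma gauss_expE k : k != 0 -> G k ^+ s = (if odd s then leg k else 1) * G 1 ^+ s.
Proof.
move=> k0; rewrite gauss_leg // exprMn; congr (_ * _).
rewrite -[in LHS](odd_double_half s) exprD -mul2n exprM expr2 leg_leg // expr1n mulr1.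
by case: (odd s).
Qed.

Lemma addchar_indicator a b : \sum_k psi (k * (a - b)) = q * (a == b)%:R.
Proof.
rewrite (eq_bigr (fun k => psi ((a - b) * k))) => [|k _]; last by rewrite mulrC.
by rewrite sum_addcharM // subr_eq0; case: eqP; rewrite ?mulr1 ?mulr0.
Qed.

Definition sphere_hat (r : K) (z : V) : algC := \sum_(m : V | sqnorm m == r) psi (dot z m).

(** The sphere is detected by characters indexed by [k]: [k = 0] gives the mass at [z = 0], and each
    other [k] a Gaussian sum evaluated by completing the square. *)
Lemma sphere_hatE r z : q * sphere_hat r z =
  (if z == 0 then q ^+ s else 0) +
  \sum_(k | k != 0) G k ^+ s * psi ((- r) * k + (- sqnorm z / 4) / k).
Proof.
rewrite /sphere_hat big_mkcond mulr_sumr.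
rewrite (eq_bigr (fun m : V => \sum_k psi (k * (sqnorm m - r)) * psi (dot z m))) => [|m _]; last first.
  by rewrite -mulr_suml addchar_indicator; case: eqP; rewrite ?mulr1 ?mulr0 ?mul0r.
rewrite exchange_big (bigD1 0) //=; congr (_ + _).
  by rewrite -(sum_psi_rV psiP psi_n); apply: eq_bigr => m _; rewrite mul0r (addchar0 psiP) mul1r.
apply: eq_bigr => k k0.
rewrite (eq_bigr (fun m : V => psi (- r * k) * psi (k * sqnorm m + dot z m))) => [|m _]; last first.
  by rewrite -!addcharD //; congr psi; ring.
rewrite -mulr_sumr sum_quadratic_rV // mulrCA -addcharD //; congr (_ * psi (_ + _)).
by field; rewrite h4 k0.
Qed.

(** The radii whose sphere has optimal Fourier decay: the isotropic cone is excluded in even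
    dimension. *)
Definition admissible (r : K) := odd s || (r != 0).

Lemma sphere_hat_bound r (z : V) : admissible r ->
  `|\sum_(k | k != 0) G k ^+ s * psi ((- r) * k + (- sqnorm z / 4) / k)| <= 2 * w ^+ s.+1.
Proof.
move=> adm_r; set c := - sqnorm z / 4.
rewrite (eq_bigr (fun k => G 1 ^+ s * ((if odd s then leg k else 1) * psi (- r * k + c / k)))) => [|k k0];
  last by rewrite gauss_expE // mulrA [_ * G 1 ^+ s]mulrC.
rewrite -mulr_sumr normrM normrX norm_gauss ?oner_neq0 // exprS mulrA [X in _ <= X]mulrC.
rewrite ler_wpM2l ?exprn_ge0 ?rtq_ge0 //.
have [odds|evens] := boolP (odd s); first exact: salie_bound.
move: adm_r; rewrite /admissible (negPf evens) /= => r0.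
rewrite (eq_bigr (fun k => psi (- r * k + c / k))) => [|k _]; last by rewrite mul1r.
by apply: kloosterman_bound => //; rewrite oppr_eq0.
Qed.

Definition tau2 (E : {set V}) (r : K) : algC := \sum_(m : V | sqnorm m == r) `|hat E m| ^+ 2.

Lemma tau2_ge0 E r : 0 <= tau2 E r.
Proof. by apply: sumr_ge0 => m _; rewrite exprn_ge0. Qed.

Lemma sum_tau2 E : \sum_r tau2 E r = q ^+ s * #|E|%:R.
Proof. by rewrite -(parseval psiP psi_n) (partition_big (@sqnorm K s) predT). Qed.

Lemma tau2_sphere E r : tau2 E r = \sum_(x in E) \sum_(y in E) sphere_hat r (x - y).
Proof.
rewrite /tau2; under eq_bigr => m _ do rewrite normCK hat_conj // big_distrlr /=.
rewrite exchange_big /=; apply: eq_bigr => x _; rewrite exchange_big /=.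
apply: eq_bigr => y _; apply: eq_bigr => m _.
by rewrite dotBl (addcharD psiP).
Qed.

(** Expanding the square gives sphere transforms at differences [x - y]. The diagonal produces the
    first term, and the Fourier decay, applied to all pairs, the second. *)
Lemma tau2_bound E r : admissible r ->
  q * tau2 E r <= q ^+ s * #|E|%:R + 2 * #|E|%:R ^+ 2 * w ^+ s.+1.
Proof.
move=> adm_r; pose err (z : V) := \sum_(k | k != 0) G k ^+ s * psi ((- r) * k + (- sqnorm z / 4) / k).
have E1 : q * tau2 E r = q ^+ s * #|E|%:R + \sum_(x in E) \sum_(y in E) err (x - y).
  have -> : q ^+ s * #|E|%:R = \sum_(x in E) q ^+ s by rewrite sumr_const mulr_natr.
  rewrite tau2_sphere mulr_sumr -big_split /=.
  apply: eq_bigr => x xE; rewrite mulr_sumr.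
  rewrite (eq_bigr (fun y => (if x == y then q ^+ s else 0) + err (x - y))) => [|y _].
    rewrite big_split /=; congr (_ + _); rewrite (bigD1 x) //= eqxx big1 ?addr0 // => y /andP[_ yx].
    by rewrite eq_sym (negPf yx).
  by rewrite sphere_hatE subr_eq0.
rewrite -[leLHS]ger0_norm ?mulr_ge0 ?tau2_ge0 ?ler0n // E1.
apply: le_trans (ler_normD _ _) _; rewrite ger0_norm ?mulr_ge0 ?exprn_ge0 ?ler0n // lerD2l.
apply: le_trans (ler_norm_sum _ _ _) _.
apply: (@le_trans _ _ (\sum_(x in E) \sum_(y in E) 2 * w ^+ s.+1)).
  apply: ler_sum => x _; apply: le_trans (ler_norm_sum _ _ _) _; apply: ler_sum => y _.
  exact: sphere_hat_bound.
by rewrite !sumr_const -[leLHS]mulrnA -[leLHS]mulr_natr natrM -expr2 mulrAC.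
Qed.

Variables E F : {set V}.
Local Notation e := (#|E|%:R : algC).
Local Notation f := (#|F|%:R : algC).

Definition expsum (l : K) : algC := \sum_(x in E) \sum_(y in F) psi (l * sqnorm (x - y)).
Definition tau (r : K) : algC := \sum_(m : V | sqnorm m == r) hat E m * (hat F m)^*.
(** Completing the square turns [psi (l * sqnorm z)] into a mean over [m] of
    [psi (dual l * sqnorm m + dot z m)]. *)
Definition dual (l : K) : K := - (4 * l)^-1.

Lemma dual_neq0 l : l != 0 -> dual l != 0.
Proof. by move=> l0; rewrite oppr_eq0 invr_eq0 mulf_neq0. Qed.

Lemma dual_inj : injective dual.
Proof. by move=> x y /oppr_inj /invr_inj /(mulfI h4). Qed.

Lemma expsum_hat l : l != 0 ->
  G (dual l) ^+ s * expsum l = \sum_m psi (dual l * sqnorm m) * (hat E m * (hat F m)^*).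
Proof.
move=> l0; have k0 := dual_neq0 l0.
under [RHS]eq_bigr => m _ do rewrite hat_conj // big_distrlr /= mulr_sumr.
rewrite exchange_big /= /expsum mulr_sumr; apply: eq_bigr => x _.
under [RHS]eq_bigr => m _ do rewrite mulr_sumr.
rewrite exchange_big /= mulr_sumr; apply: eq_bigr => y _.
have -> : l * sqnorm (x - y) = - sqnorm (x - y) / (4 * dual l).
  by rewrite /dual; field; rewrite h4 l0 oppr_eq0 oner_neq0.
rewrite -(sum_quadratic_rV oddK psiP) ?dual_neq0 //; apply: eq_bigr => m _.
by rewrite -!addcharD // dotBl.
Qed.

Lemma expsum_tau l : l != 0 ->
  expsum l = (G (dual l) ^+ s)^-1 * \sum_r psi (dual l * r) * tau r.
Proof.
move=> l0; have g0 : G (dual l) ^+ s != 0 by rewrite expf_neq0 // gauss_neq0 // dual_neq0.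
apply: (mulfI g0); rewrite mulVKf // expsum_hat // (partition_big (@sqnorm K s) predT) //=.
apply: eq_bigr => r _; rewrite mulr_sumr; by apply: eq_bigr => m /eqP <-.
Qed.

Lemma expsum_bound l : l != 0 -> `|expsum l| ^+ 2 <= q ^+ s * (e * f).
Proof.
move=> l0; have k0 := dual_neq0 l0.
have qs0 : 0 < q ^+ s by rewrite exprn_gt0.
rewrite -(ler_pM2l qs0) -[leLHS](_ : `|G (dual l) ^+ s * expsum l| ^+ 2 = _); last first.
  by rewrite normrM exprMn norm_gauss_sqr.
rewrite expsum_hat //; under eq_bigr do rewrite mulrA.
apply: le_trans (CS _ _ _) _.
rewrite (eq_bigr (fun m => `|hat E m| ^+ 2)) => [|m _]; last first.
  by rewrite normrM (norm_addchar psiP) mul1r.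
rewrite [X in _ * X](eq_bigr (fun m => `|hat F m| ^+ 2)) => [|m _]; last by rewrite norm_conjC.
by rewrite !(parseval psiP psi_n) mulrACA -mulrA.
Qed.

Lemma tau_bound r : `|tau r| ^+ 2 <= tau2 E r * tau2 F r.
Proof.
apply: le_trans (CS _ _ _) _; rewrite ler_wpM2l ?tau2_ge0 //.
by under eq_bigr do rewrite norm_conjC.
Qed.

Definition Nt (t : K) : algC := \sum_(x in E) \sum_(y in F) (sqnorm (x - y) == t)%:R.

Lemma Nt_expsum t : q * Nt t = \sum_l psi (l * - t) * expsum l.
Proof.
rewrite /Nt mulr_sumr; under [RHS]eq_bigr => l _ do rewrite mulr_sumr.
rewrite [RHS]exchange_big /=; apply: eq_bigr => x _.
rewrite mulr_sumr; under [RHS]eq_bigr => l _ do rewrite mulr_sumr.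
rewrite [RHS]exchange_big /=; apply: eq_bigr => y _.
rewrite -addchar_indicator; apply: eq_bigr => l _.
by rewrite -(addcharD psiP) mulrDr addrC.
Qed.

Lemma expsum0 : expsum 0 = e * f.
Proof.
rewrite /expsum (eq_bigr (fun=> f)) => [|x _]; first by rewrite sumr_const [RHS]mulr_natl.
rewrite (eq_bigr (fun=> 1)) ?sumr_const // => y _.
by rewrite mul0r addchar0.
Qed.

Lemma sum_Nt : \sum_t Nt t = e * f.
Proof.
rewrite -expsum0 /Nt /expsum exchange_big /=; apply: eq_bigr => x _.
rewrite exchange_big /=; apply: eq_bigr => y _.
rewrite mul0r (addchar0 psiP) (bigD1 (sqnorm (x - y))) //= eqxx big1 ?addr0 // => t tn.
by rewrite eq_sym (negPf tn).
Qed.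

Lemma Nt_ge0 t : 0 <= Nt t.
Proof. by apply: sumr_ge0 => x _; apply: sumr_ge0 => y _; rewrite ler0n. Qed.

Lemma Nt_eq0 t : t \notin dist_set E F -> Nt t = 0.
Proof.
move=> tn; rewrite /Nt big1 // => x xE; rewrite big1 // => y yF.
by case: eqP => // E1; case/negP: tn; rewrite -E1; apply/imset2P; exists x y.
Qed.

(** The radii in [expsum_tau] are separated: in even dimension [expsum_cone] keeps radius zero, and
    [expsum_main] keeps the radii with good decay. [cone] and [fluct] are their contributions to the
    count at distance [t]. *)
Definition expsum_main (l : K) : algC := (G (dual l) ^+ s)^-1 * \sum_(r | admissible r) psi (dual l * r) * tau r.
Definition expsum_cone (l : K) : algC := (G (dual l) ^+ s)^-1 * \sum_(r | ~~ admissible r) psi (dual l * r) * tau r.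
Definition fluct (t : K) : algC := \sum_(l | l != 0) psi (l * - t) * expsum_main l.
Definition cone (t : K) : algC := \sum_(l | l != 0) psi (l * - t) * expsum_cone l.

Lemma Nt_split t : q * Nt t = e * f + cone t + fluct t.
Proof.
rewrite Nt_expsum (bigD1 0) //= mul0r (addchar0 psiP) mul1r expsum0 -addrA; congr (_ + _).
rewrite /cone /fluct -big_split /=; apply: eq_bigr => l l0; rewrite -mulrDr; congr (_ * _).
rewrite expsum_tau // /expsum_cone /expsum_main -mulrDr; congr (_ * _).
by rewrite (bigID admissible) /= addrC.
Qed.

(** In even dimension [expsum_cone l] is the same for all [l != 0], and for [t != 0] the sum of
    [psi (l * - t)] over these [l] is only [-1]. *)
Lemma cone_bound t : t != 0 -> `|cone t| ^+ 2 <= q ^+ s * (e * f).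
Proof.
move=> t0; have X0 : 0 <= q ^+ s * (e * f) by rewrite !mulr_ge0 ?exprn_ge0 ?ler0n.
have [odds|evens] := boolP (odd s).
  rewrite [cone t]big1 ?normr0 ?expr0n // => l _.
  by rewrite /expsum_cone big_pred0 ?mulr0 // => r; rewrite /admissible odds.
have coneE l : l != 0 -> expsum_cone l = (G 1 ^+ s)^-1 * tau 0.
  move=> l0; rewrite /expsum_cone gauss_expE ?dual_neq0 // (negPf evens) /= mul1r; congr (_ * _).
  rewrite (big_pred1 0) => [|r]; first by rewrite mulr0 (addchar0 psiP) mul1r.
  by rewrite /admissible (negPf evens) /= negbK.
rewrite /cone (eq_bigr (fun l => psi (- t * l) * ((G 1 ^+ s)^-1 * tau 0))) => [|l l0]; last first.
  by rewrite coneE // [l * _]mulrC.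
rewrite -mulr_suml; have := sum_addcharM psiP (- t) psi_n; rewrite oppr_eq0 (negPf t0).
rewrite (bigD1 0) //= mulr0 (addchar0 psiP) => /eqP; rewrite addrC addr_eq0 => /eqP ->.
rewrite mulN1r normrN normrM exprMn normfV exprVn norm_gauss_sqr ?oner_neq0 //.
have qs0 : 0 < q ^+ s by rewrite exprn_gt0.
rewrite ler_pdivrMl //; apply: le_trans (tau_bound 0) _.
apply: (@le_trans _ _ ((q ^+ s * e) * (q ^+ s * f))); last by rewrite mulrACA -mulrA.
have le1 (H : {set V}) : tau2 H 0 <= q ^+ s * #|H|%:R.
  by rewrite -sum_tau2 (bigD1 0) //= lerDl; apply: sumr_ge0 => r _; apply: tau2_ge0.
by rewrite ler_pM ?tau2_ge0.
Qed.

(** Parseval is used twice, from [t] to [l] and from [l] to the radius [r]. There [tau_bound] and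
    the hypothesis give at most [B * tau2 F r], and the masses of [F] are summed over all radii. *)
Lemma fluct_bound B : 0 <= B -> (forall r, admissible r -> tau2 E r <= B) ->
  \sum_t `|fluct t| ^+ 2 <= q ^+ 2 * B * f.
Proof.
move=> B0 leB; have qs0 : 0 < q ^+ s by rewrite exprn_gt0.
pose c l := if l != 0 then expsum_main l else 0.
have -> : \sum_t `|fluct t| ^+ 2 = q * \sum_l `|c l| ^+ 2.
  rewrite -(parseval1 psiP psi_n) (reindex_inj oppr_inj) /=; apply: eq_bigr => t _.
  congr (`|_| ^+ 2); rewrite /fluct big_mkcond; apply: eq_bigr => l _.
  by rewrite opprK /c; case: (l != 0); rewrite ?mul0r // mulrC.
rewrite expr2 -!mulrA ler_pM2l //.
pose d r := if admissible r then tau r else 0.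
(* The value [l = 0], where [c l] is zero, is included so that the sum runs over all of [K], on
   which [dual] is a bijection. *)
have cle l : `|c l| ^+ 2 <= (q ^+ s)^-1 * `|\sum_r d r * psi (r * dual l)| ^+ 2.
  rewrite /c; case: eqP => [_|/eqP l0] /=.
    by rewrite normr0 expr0n mulr_ge0 ?exprn_ge0 // invr_ge0 ltW.
  rewrite /expsum_main normrM exprMn normfV exprVn norm_gauss_sqr ?dual_neq0 //.
  have -> : \sum_(r | admissible r) psi (dual l * r) * tau r = \sum_r d r * psi (r * dual l).
    rewrite big_mkcond; apply: eq_bigr => r _; rewrite /d; case: admissible; rewrite ?mul0r //.
    by rewrite mulrC [r * _]mulrC.
  by rewrite lexx.
apply: le_trans (ler_sum _ (fun l _ => cle l)) _.
rewrite -mulr_sumr ler_pdivrMl //.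
have -> : \sum_l `|\sum_r d r * psi (r * dual l)| ^+ 2 = q * \sum_r `|d r| ^+ 2.
  by rewrite -(parseval1 psiP psi_n) [RHS](reindex_inj dual_inj).
rewrite mulrCA ler_pM2l //.
apply: (@le_trans _ _ (\sum_r B * tau2 F r)); last by rewrite -mulr_sumr sum_tau2 mulrCA.
apply: ler_sum => r _; rewrite /d; case: (boolP (admissible r)) => [gr|_].
  by apply: le_trans (tau_bound r) _; rewrite ler_wpM2r ?tau2_ge0 ?leB.
by rewrite normr0 expr0n mulr_ge0 ?tau2_ge0.
Qed.
End Distances.

(** * From spherical L2 mass to the number of distances *)

Section DistCore.
Variables (K : finFieldType) (psi : K -> algC) (s : nat).
Hypothesis oddK : odd #|K|.
Hypothesis psiP : addchar psi.
Hypothesis psi_n : nontrivial psi.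
Local Notation q := (#|K|%:R : algC).
Local Notation w := (rtq K).
Variables E F : {set 'rV[K]_s}.
Local Notation e := (#|E|%:R : algC).
Local Notation f := (#|F|%:R : algC).
Local Notation X := (e * f).
Hypothesis large : 900 * q ^+ s <= e * f.

Let q_gt0 : 0 < q. Proof. by rewrite ltr0n (ltnW (finNzRing_gt1 K)). Qed.
Let X_gt0 : 0 < X.
Proof. by apply: lt_le_trans large; rewrite mulr_gt0 ?ltr0n ?exprn_gt0. Qed.

(** This is where the constant [900 = 30 ^ 2] enters: an error of size [sqrt (q ^ s * X)] is at most
    [X / 30]. *)
Let small (z : algC) : `|z| ^+ 2 <= q ^+ s * X -> 30 * `|z| <= X.
Proof.
move=> zX; rewrite -(@ler_pXn2r _ 2) ?nnegrE ?mulr_ge0 ?ler0n // exprMn.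
have -> : 30 ^+ 2 = 900 :> algC by rewrite -natrX.
rewrite [X in _ <= X]expr2.
apply: (@le_trans _ _ (900 * q ^+ s * X)); first by rewrite -mulrA ler_wpM2l ?ler0n.
by rewrite ler_wpM2r // ltW.
Qed.

Lemma card_finField_odd_ge3 : (3 <= #|K|)%N.
Proof. by have := finNzRing_gt1 K; case: #|K| oddK => [|[|[|n]]]. Qed.

(** Since [cone_bound] excludes [t = 0], all nonzero frequencies are bounded in absolute value here.
    With [3 <= q], at most [11 / 30] of the pairs are at distance zero. *)
Lemma Nt0_bound : 30 * (q * Nt E F 0) <= 30 * X + q * X.
Proof.
rewrite -[leLHS]ger0_norm ?mulr_ge0 ?ler0n ?Nt_ge0 // normrM normr_nat.
rewrite (Nt_expsum psiP psi_n) (bigD1 0) //= mul0r (addchar0 psiP) mul1r (expsum0 psiP).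
apply: le_trans (ler_wpM2l (ler0n _ _) (ler_normD _ _)) _.
rewrite mulrDr (ger0_norm (ltW X_gt0)) lerD2l.
apply: le_trans (ler_wpM2l (ler0n _ _) (ler_norm_sum _ _ _)) _.
rewrite mulr_sumr; apply: (@le_trans _ _ (\sum_(l : K | l != 0) X)).
  apply: ler_sum => l l0; rewrite normrM (norm_addchar psiP) mul1r.
  exact: small (expsum_bound oddK psiP psi_n _ _ l0).
by rewrite sumr_const -[leLHS]mulr_natl ler_wpM2r ?(ltW X_gt0) // ler_nat max_card.
Qed.

(** With few distances, the mean value and the cone cannot account for the pairs at nonzero
    distance, so the fluctuations over [T] must sum to at least [q * X / 2]; Cauchy-Schwarz and
    [fluct_bound] limit that sum. *)
Lemma dist_core B : 0 <= B -> (forall r, admissible s r -> tau2 psi E r <= B) ->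
  (#|K| <= 8 * #|dist_set E F|)%N \/ e * X <= 4 * #|dist_set E F|%:R * B.
Proof.
move=> B0 leB; case: leqP => [?|ltD]; [by left | right].
pose T := dist_set E F :\ 0; pose D := #|dist_set E F|.
have TD : (#|T| <= D)%N by rewrite subset_leq_card // subD1set.
pose Y := \sum_(t in T) `|fluct psi E F t|.
have Y0 : 0 <= Y by apply: sumr_ge0.
have sumT : \sum_(t in T) Nt E F t = X - Nt E F 0.
  have := sum_Nt psiP E F; rewrite (bigD1 0) //= => <-; rewrite [RHS]addrC addKr; apply/esym.
  rewrite [LHS]big_mkcond [RHS]big_mkcond; apply: eq_bigr => t _; rewrite !inE.
  case: eqP => //= _; case: ifP => // /negbT; exact: Nt_eq0.
have step1 : 30 * q * (X - Nt E F 0) <= 31 * D%:R * X + 30 * Y.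
  rewrite -sumT mulr_sumr.
  apply: (@le_trans _ _ (\sum_(t in T) (31 * X + 30 * `|fluct psi E F t|))).
    apply: ler_sum => t; rewrite !inE => /andP[t0 _].
    rewrite -[leLHS]ger0_norm ?mulr_ge0 ?ler0n ?Nt_ge0 // -mulrA normrM normr_nat.
    rewrite (Nt_split oddK psiP psi_n).
    apply: le_trans (ler_wpM2l (ler0n _ _) (ler_normD _ _)) _; rewrite mulrDr lerD2r.
    apply: le_trans (ler_wpM2l (ler0n _ _) (ler_normD _ _)) _; rewrite mulrDr.
    have -> : 31 * X = 30 * X + X by ring.
    rewrite (ger0_norm (ltW X_gt0)) lerD2l.
    exact: small (cone_bound oddK psiP psi_n _ _ t0).
  rewrite big_split /= -[X in _ + X]mulr_sumr sumr_const lerD2r -[leLHS]mulr_natl mulrA [_ * 31]mulrC.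
  by rewrite ler_wpM2r ?(ltW X_gt0) // ler_wpM2l ?ler0n // ler_nat.
have step2 : Y ^+ 2 <= D%:R * (q ^+ 2 * B * f).
  have -> : Y = \sum_(t in T) 1 * `|fluct psi E F t| by apply: eq_bigr => t _; rewrite mul1r.
  apply: (@le_trans _ _ ((\sum_(t in T) 1 ^+ 2) * (\sum_(t in T) `|fluct psi E F t| ^+ 2))).
    by apply: real_CS => t; rewrite ?rpred1 ?normr_real.
  apply: ler_pM; [by apply: sumr_ge0 => t _; rewrite exprn_ge0 ?ler01|by apply: sumr_ge0 => t _; rewrite exprn_ge0| |].
    by rewrite (eq_bigr (fun=> 1)) => [|t _]; rewrite ?expr1n // sumr_const ler_nat.
  apply: le_trans (fluct_bound oddK psiP psi_n F B0 leB).
  by rewrite [leRHS](bigID (mem T)) /= lerDl sumr_ge0 // => t _; rewrite exprn_ge0.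
have step3 : q * X <= 2 * Y.
  have a1 : 30 * X <= 10 * q * X.
    by rewrite ler_wpM2r ?(ltW X_gt0) // -natrM ler_nat (leq_mul2l 10 3) card_finField_odd_ge3 orbT.
  have a2 : 8 * D%:R * X <= q * X.
    by rewrite ler_wpM2r ?(ltW X_gt0) // -natrM ler_nat ltnW.
  have a3 := Nt0_bound.
  rewrite -(ler_pM2l (_ : 0 < 120 :> algC)) ?ltr0n //.
  rewrite -subr_ge0; set N0 := Nt E F 0 in step1 a3.
  (* A nonnegative combination of [step1], [a3], [a1] and [a2], with weights chosen to cancel [N0],
     [D] and the bare [X]. *)
  have -> : 120 * (2 * Y) - 120 * (q * X) =
     8 * (31 * D%:R * X + 30 * Y - 30 * q * (X - N0)) + 8 * (30 * X + q * X - 30 * (q * N0))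
     + 8 * (10 * q * X - 30 * X) + 31 * (q * X - 8 * D%:R * X) + q * X by ring.
  by rewrite !addr_ge0 ?mulr_ge0 ?ler0n ?subr_ge0 // ?ltW.
have f0 : 0 < f by move: X_gt0; rewrite pmulr_rgt0 // lt_def ler0n andbT; case: (e =P 0) => // e0; move: X_gt0; rewrite e0 mul0r ltxx.
rewrite -(ler_pM2r f0) -(ler_pM2l (exprn_gt0 2 q_gt0)).
have : (q * X) ^+ 2 <= (2 * Y) ^+ 2.
  by rewrite lerXn2r // nnegrE mulr_ge0 ?ler0n ?(ltW X_gt0).
have -> : (q * X) ^+ 2 = q ^+ 2 * (e * X * f) by ring.
move/le_trans; apply; rewrite exprMn.
have -> : q ^+ 2 * (4 * #|dist_set E F|%:R * B * f) = 2 ^+ 2 * (D%:R * (q ^+ 2 * B * f)) by rewrite /D; ring.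
by rewrite ler_wpM2l ?exprn_ge0 ?ler0n.
Qed.

End DistCore.

(** * Circles in the plane *)

Section Circle.
Variables (K : finFieldType).
Hypothesis oddK : odd #|K|.
Local Notation V := 'rV[K]_2.

Let h2 : 2 != 0 :> K. Proof. exact: two_neq0. Qed.

Lemma sqnorm2 (m : V) : sqnorm m = m 0 0 ^+ 2 + m 0 1 ^+ 2.
Proof.
rewrite /sqnorm !big_ord_recl big_ord0 addr0.
by congr (_ + m _ _ ^+ 2); apply: val_inj.
Qed.

Lemma row2P (m m' : V) : m 0 0 = m' 0 0 -> m 0 1 = m' 0 1 -> m = m'.
Proof.
move=> E0 E1; apply/rowP => i; case: i => [[|[|i]] lti] //.
  by rewrite (_ : Ordinal lti = 0) //; apply: val_inj.
by rewrite (_ : Ordinal lti = 1) //; apply: val_inj.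
Qed.

(** Subtracting the two equations puts [m] on a line perpendicular to [z]. Along it, with [m0] as
    origin, the circle equation becomes [l * (2 * d + l * n) = 0]. *)
Lemma circle_reps (r : K) (z : V) : r != 0 -> z != 0 ->
  (#|[set m : V | ((sqnorm m == r) && (sqnorm (z - m) == r))%R]| <= 2)%N.
Proof.
move=> r0 z0; set S := [set m | _].
have [->|[m0 m0S]] := set_0Vmem S; first by rewrite cards0.
pose a := z 0 0; pose b := z 0 1; pose x := m0 0 0; pose y := m0 0 1.
have SE (m : V) : m \in S -> m 0 0 ^+ 2 + m 0 1 ^+ 2 = r /\ 2 * (a * m 0 0 + b * m 0 1) = a ^+ 2 + b ^+ 2.
  rewrite inE !sqnorm2 !mxE -/a -/b => /andP[/eqP E1 /eqP E2]; split=> //.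
  by apply: (eq_from_subr (c := r) (d := r)); rewrite // -[X in _ = X - _]E1 -[in RHS]E2; ring.
have [m0r m0z] := SE _ m0S; rewrite -/x -/y in m0r m0z.
have ab0 : (a != 0) || (b != 0).
  rewrite -negb_and; apply: contra z0 => /andP[/eqP a0 /eqP b0]; apply/eqP.
  by apply: row2P; rewrite mxE.
pose n := a ^+ 2 + b ^+ 2; pose d := a * y - b * x.
have nondeg : n = 0 -> d != 0.
  move=> n0; apply/eqP => d0; case/negP: r0; rewrite -m0r.
  have e0 : a * x + b * y = 0.
    by apply: (mulfI h2); rewrite m0z -/n n0 mulr0.
  have ax : a ^+ 2 * (x ^+ 2 + y ^+ 2) = 0.
    have -> : a ^+ 2 * (x ^+ 2 + y ^+ 2) = (a * x + b * y) * (a * x - b * y) + n * y ^+ 2 by rewrite /n; ring.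
    by rewrite e0 n0 !mul0r addr0.
  have bx : b ^+ 2 * (x ^+ 2 + y ^+ 2) = 0.
    have -> : b ^+ 2 * (x ^+ 2 + y ^+ 2) = (a * x + b * y) * (b * y - a * x) + n * x ^+ 2 by rewrite /n; ring.
    by rewrite e0 n0 !mul0r addr0.
  case/orP: ab0 => [a0|b0].
    by rewrite -(mulrI_eq0 _ (mulfI (expf_neq0 2 a0))) ax.
  by rewrite -(mulrI_eq0 _ (mulfI (expf_neq0 2 b0))) bx.
pose m1 : V := \row_i (if i == 0 then x - (- 2 * d / n) * b else y + (- 2 * d / n) * a).
apply: leq_trans (_ : #|[set m0; m1]| <= 2)%N; last by rewrite cards2; case: eqP.
apply: subset_leq_card; apply/subsetP => m /SE[mr mz].
have [l [lx ly]] : exists l, m 0 0 = x - l * b /\ m 0 1 = y + l * a.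
  have E : a * (m 0 0 - x) + b * (m 0 1 - y) = 0.
    apply: (mulfI h2); rewrite mulr0; apply: (eq_from_subr (c := n) (d := n)) => //.
    rewrite -[X in _ = X - _]mz -[X in _ = _ - X]m0z; ring.
  case/orP: ab0 => [a0|b0].
    exists ((m 0 1 - y) / a); split; last by field.
    apply: (mulfI a0); apply: (eq_from_subr _ E); field; exact: a0.
  exists (- (m 0 0 - x) / b); split; first by field.
  apply: (mulfI b0); apply: (eq_from_subr _ E); field; exact: b0.
have El : l * (2 * d + l * n) = 0.
  apply: (eq_from_subr (c := r) (d := r)) => //.
  rewrite -[X in _ = X - _]mr -[X in _ = _ - X]m0r lx ly /d /n; ring.
rewrite !inE; have [l0|l0] := eqVneq l 0.
  by apply/orP; left; apply/eqP/row2P; rewrite ?lx ?ly l0 mul0r ?subr0 ?addr0.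
move/eqP: El; rewrite mulf_eq0 (negPf l0) /= => /eqP El.
have n0 : n != 0.
  apply/eqP => n0; have /eqP := nondeg n0; apply.
  by apply: (mulfI h2); rewrite mulr0 -El n0 mulr0 addr0.
have lE : l = - 2 * d / n.
  apply: (mulIf n0); rewrite divfK //; apply: (eq_from_subr _ El); ring.
by apply/orP; right; apply/eqP/row2P; rewrite mxE /= -lE.
Qed.
End Circle.

Section CircleEnergy.
Variables (K : finFieldType) (psi : K -> algC).
Hypothesis oddK : odd #|K|.
Hypothesis psiP : addchar psi.
Hypothesis psi_n : nontrivial psi.
Local Notation q := (#|K|%:R : algC).
Local Notation V := 'rV[K]_2.
Variables (E : {set V}) (r : K).
Hypothesis r0 : r != 0.
Local Notation e := (#|E|%:R : algC).

(** [b] is the conjugate transform of [E] cut to the circle and [g] its Fourier extension. By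
    duality [t] is the sum of [g] over [E], so a fourth moment bound for [g] bounds [t]. *)
Let b (m : V) : algC := if sqnorm m == r then (hat psi E m)^* else 0.
Let g (x : V) : algC := \sum_m b m * psi (dot m x).
Let t := tau2 psi E r.

Let t_b : t = \sum_m `|b m| ^+ 2.
Proof.
rewrite /t /tau2 big_mkcond; apply: eq_bigr => m _; rewrite /b.
by case: eqP; rewrite ?norm_conjC // normr0 expr0n.
Qed.

Let t_ge0 : 0 <= t. Proof. exact: tau2_ge0. Qed.

Let t_g : t = \sum_(x in E) g x.
Proof.
rewrite /g exchange_big t_b; apply: eq_bigr => m _.
rewrite -mulr_sumr (eq_bigr (fun x => psi (dot x m))) => [|x _]; last by rewrite dotC.
rewrite -/(hat psi E m) /b; case: eqP; last by rewrite normr0 expr0n mul0r.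
by rewrite norm_conjC normCK mulrC.
Qed.

(** The convolution of [b] with itself, whose transform is the square of [g]. *)
Let c (z : V) : algC := \sum_m b m * b (z - m).

Let g_sqr x : g x ^+ 2 = \sum_z c z * psi (dot z x).
Proof.
rewrite expr2 /g big_distrlr /=.
under [RHS]eq_bigr => z _ do rewrite /c mulr_suml.
rewrite [RHS]exchange_big; apply: eq_bigr => m _.
rewrite [RHS](reindex_inj (addrI m)) /=; apply: eq_bigr => m' _.
rewrite (_ : m + m' - m = m'); last by rewrite addrAC subrr add0r.
by rewrite [dot (m + m') x]dotC dotDr (addcharD psiP) [dot x m]dotC [dot x m']dotC mulrACA.
Qed.

Let b_supp m : b m != 0 -> sqnorm m == r.
Proof. by rewrite /b; case: ifP => //; rewrite eqxx. Qed.

Let c_offdiag z : z != 0 -> `|c z| ^+ 2 <= 2 * \sum_m (`|b m| ^+ 2 * `|b (z - m)| ^+ 2).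
Proof.
move=> z0; pose S := [set m : V | (sqnorm m == r) && (sqnorm (z - m) == r)].
have -> : c z = \sum_(m in S) 1 * (b m * b (z - m)).
  rewrite [RHS]big_mkcond; apply: eq_bigr => m _; rewrite inE mul1r.
  case: ifP => // /negbT; rewrite negb_and => H.
  by apply/eqP; rewrite mulf_eq0; case/orP: H => H; apply/orP; [left | right];
    apply: contraNT H; apply: b_supp.
apply: le_trans (CS _ _ _) _; apply: ler_pM.
- by apply: sumr_ge0 => m _; rewrite exprn_ge0.
- by apply: sumr_ge0 => m _; rewrite exprn_ge0.
- rewrite (eq_bigr (fun=> 1)) => [|m _]; last by rewrite normr1 expr1n.
  by rewrite sumr_const ler_nat; apply: circle_reps.
rewrite [leRHS](bigID (mem S)) /= -[leLHS]addr0 lerD //.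
  by rewrite le_eqVlt; apply/orP; left; apply/eqP/eq_bigr => m _; rewrite normrM exprMn.
by apply: sumr_ge0 => m _; rewrite mulr_ge0 ?exprn_ge0.
Qed.

Let c_diag : `|c 0| ^+ 2 <= t ^+ 2.
Proof.
apply: le_trans (CS _ _ _) _; rewrite -t_b expr2 ler_wpM2l //.
rewrite (reindex_inj oppr_inj) /= le_eqVlt; apply/orP; left; apply/eqP.
by rewrite t_b; apply: eq_bigr => m _; rewrite opprK add0r.
Qed.

(** By Parseval the fourth moment of [g] is the second moment of [c]. The term [z = 0] gives at most
    [t ^+ 2]; for other [z] at most two terms of the convolution survive, giving [2 * t ^+ 2] in
    total. *)
Lemma circle_energy : \sum_x `|g x| ^+ 4 <= q ^+ 2 * (3 * t ^+ 2).
Proof.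
rewrite (eq_bigr (fun x => `|\sum_z c z * psi (dot z x)| ^+ 2)) => [|x _]; last first.
  by rewrite -g_sqr normrX -exprM.
rewrite (parseval_rV psiP psi_n) ler_wpM2l ?exprn_ge0 ?ler0n //.
rewrite (bigD1 0) //=; have -> : 3 * t ^+ 2 = t ^+ 2 + 2 * t ^+ 2 by ring.
apply: lerD c_diag _.
apply: (@le_trans _ _ (\sum_(z : V) 2 * \sum_m (`|b m| ^+ 2 * `|b (z - m)| ^+ 2))).
  rewrite [leRHS](bigD1 0) //= -[leLHS]add0r lerD //.
    by rewrite mulr_ge0 ?ler0n ?sumr_ge0 // => m _; rewrite mulr_ge0 ?exprn_ge0.
  by apply: ler_sum => z; apply: c_offdiag.
rewrite -mulr_sumr ler_wpM2l ?ler0n // exchange_big /=.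
rewrite le_eqVlt; apply/orP; left; apply/eqP.
rewrite expr2 {1}t_b mulr_suml; apply: eq_bigr => m _.
rewrite (reindex_inj (addIr m)) /= -mulr_sumr t_b; congr (_ * _).
by apply: eq_bigr => z _; rewrite addrK.
Qed.

(** Two applications of Cauchy-Schwarz on [E] give [t ^+ 4 <= e ^+ 3] times the fourth moment of
    [g], which is itself a multiple of [t ^+ 2]; dividing by [t ^+ 2] concludes. *)
Lemma circle_tau2_bound : t ^+ 2 <= 3 * q ^+ 2 * e ^+ 3.
Proof.
have [->|tn] := eqVneq t 0; first by rewrite expr0n !mulr_ge0 ?exprn_ge0 ?ler0n.
have tp : 0 < t by rewrite lt_def tn.
pose Y := \sum_(x in E) `|g x| ^+ 2.
have Y0 : 0 <= Y by apply: sumr_ge0 => x _; rewrite exprn_ge0.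
have s1 : t ^+ 2 <= e * Y.
  rewrite -[t](ger0_norm t_ge0) t_g (eq_bigr (fun x => 1 * g x)) => [|x _]; last by rewrite mul1r.
  apply: le_trans (CS _ _ _) _; rewrite ler_wpM2r //.
  by rewrite (eq_bigr (fun=> 1)) ?sumr_const // => x _; rewrite normr1 expr1n.
have s2 : Y ^+ 2 <= e * (q ^+ 2 * (3 * t ^+ 2)).
  apply: le_trans (ler_wpM2l (ler0n _ _) circle_energy).
  rewrite /Y (eq_bigr (fun x => 1 * `|g x| ^+ 2)) => [|x _]; last by rewrite mul1r.
  apply: le_trans (real_CS _ _ _) _.
  - by move=> x; rewrite rpred1.
  - by move=> x; rewrite rpredX ?normr_real.
  apply: ler_pM.
  - by apply: sumr_ge0 => x _; rewrite exprn_ge0 ?ler01.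
  - by apply: sumr_ge0 => x _; rewrite -exprM exprn_ge0.
  - by rewrite (eq_bigr (fun=> 1)) ?sumr_const // => x _; rewrite expr1n.
  rewrite [leRHS](bigID (mem E)) /= -[leLHS]addr0 lerD //.
    by rewrite le_eqVlt; apply/orP; left; apply/eqP/eq_bigr => x _; rewrite -exprM.
  by apply: sumr_ge0 => x _; rewrite exprn_ge0.
rewrite -(ler_pM2l (exprn_gt0 2 tp)) -expr2 -exprM.
apply: (@le_trans _ _ ((e * Y) ^+ 2)).
  by rewrite (exprM t 2 2) lerXn2r // nnegrE ?exprn_ge0 ?mulr_ge0 ?ler0n.
rewrite exprMn; apply: le_trans (ler_wpM2l (exprn_ge0 2 (ler0n _ _)) s2) _.
by rewrite le_eqVlt; apply/orP; left; apply/eqP; ring.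
Qed.
End CircleEnergy.

(** * Lower bounds in integer form *)

Section NatBounds.
Variables (K : finFieldType).
Hypothesis oddK : odd #|K|.

Lemma dist_set_lower_nat s (E F : {set 'rV[K]_s.+1}) :
  (900 * #|K| ^ s.+1 <= #|E| * #|F|)%N ->
  (#|K| <= 8 * #|dist_set E F|)%N \/
  (#|F| ^ 2 <= 256 * (#|dist_set E F| ^ 2 * #|K| ^ s))%N.
Proof.
move=> large; have [psi [psiP psi_n]] := exists_addchar K.
set D := #|dist_set E F|.
have largeC : 900 * #|K|%:R ^+ s.+1 <= #|E|%:R * #|F|%:R :> algC.
  by rewrite -natrX -!natrM ler_nat.
have q_gt0 : 0 < #|K|%:R :> algC by rewrite ltr0n (ltnW (finNzRing_gt1 K)).
pose w := rtq K; have w0 : 0 <= w := rtq_ge0 K.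
(* The bound of [tau2_bound] in dimension [s.+1], divided by [q = w ^+ 2]. *)
pose B : algC := #|E|%:R * #|K|%:R ^+ s + 2 * #|E|%:R ^+ 2 * w ^+ s.
have B0 : 0 <= B by rewrite addr_ge0 ?mulr_ge0 ?exprn_ge0 ?ler0n.
have leB r : admissible s.+1 r -> tau2 psi E r <= B.
  move=> gr; rewrite -(ler_pM2l q_gt0); apply: le_trans (tau2_bound oddK psiP psi_n E gr) _.
  by rewrite le_eqVlt; apply/orP; left; apply/eqP; rewrite /B -/w !exprS -(sqr_rtq K) -/w; ring.
case: (dist_core oddK psiP psi_n largeC B0 leB) => [|core]; first by left.
case: (leqP #|K| (8 * D)) => [|ltD]; [by left | right].
have e0 : 0 < #|E|%:R :> algC.
  rewrite ltr0n lt0n; apply/eqP => e0; move: large; rewrite e0 mul0n leqn0 muln_eq0 /=.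
  by rewrite expn_eq0 andbT; case: #|K| (ltnW (finNzRing_gt1 K)).
have ineq : #|E|%:R * #|F|%:R <= 4 * D%:R * #|K|%:R ^+ s + 8 * D%:R * #|E|%:R * w ^+ s.
  rewrite -(ler_pM2l e0); apply: le_trans core _.
  by rewrite le_eqVlt; apply/orP; left; apply/eqP; rewrite /B -/D; ring.
(* As [8 * D < q], largeness lets the first term of [ineq] be absorbed in half of the left side; the
   second then gives [fle], whose constant squares to [256]. *)
have half : 8 * D%:R * #|K|%:R ^+ s <= #|E|%:R * #|F|%:R :> algC.
  rewrite -natrX -!natrM ler_nat; apply: leq_trans large; rewrite expnS mulnA.
  by rewrite leq_mul // (leq_trans (ltnW ltD)) // leq_pmull.
have fle : #|F|%:R <= 16 * D%:R * w ^+ s.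
  rewrite -(ler_pM2l e0) -subr_ge0.
  have -> : #|E|%:R * (16 * D%:R * w ^+ s) - #|E|%:R * #|F|%:R =
    2 * (4 * D%:R * #|K|%:R ^+ s + 8 * D%:R * #|E|%:R * w ^+ s - #|E|%:R * #|F|%:R)
    + (#|E|%:R * #|F|%:R - 8 * D%:R * #|K|%:R ^+ s) by ring.
  by rewrite addr_ge0 ?mulr_ge0 ?ler0n ?subr_ge0.
have : #|F|%:R ^+ 2 <= (16 * D%:R * w ^+ s) ^+ 2.
  by rewrite lerXn2r // nnegrE ?mulr_ge0 ?exprn_ge0 ?ler0n.
have -> : (16 * D%:R * w ^+ s) ^+ 2 = (256 * (D ^ 2 * #|K| ^ s))%:R.
  by rewrite !natrM !natrX -(sqr_rtq K) -/w exprAC; ring.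
by rewrite -natrX ler_nat.
Qed.

(** Here [B] comes from the circle energy, and [48 = 4 ^ 2 * 3] from squaring the conclusion of
    [dist_core]. *)
Lemma dist_set_lower_nat2 (E F : {set 'rV[K]_2}) :
  (900 * #|K| ^ 2 <= #|E| * #|F|)%N ->
  (#|K| <= 8 * #|dist_set E F|)%N \/
  (#|E| * #|F| ^ 2 <= 48 * (#|dist_set E F| ^ 2 * #|K| ^ 2))%N.
Proof.
move=> large; have [psi [psiP psi_n]] := exists_addchar K.
set D := #|dist_set E F|.
have largeC : 900 * #|K|%:R ^+ 2 <= #|E|%:R * #|F|%:R :> algC.
  by rewrite -natrX -!natrM ler_nat.
pose B : algC := sqrtC (3 * #|K|%:R ^+ 2 * #|E|%:R ^+ 3).
have BB0 : 0 <= 3 * #|K|%:R ^+ 2 * #|E|%:R ^+ 3 :> algC by rewrite !mulr_ge0 ?exprn_ge0 ?ler0n.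
have B0 : 0 <= B by rewrite sqrtC_ge0.
have leB r : admissible 2 r -> tau2 psi E r <= B.
  rewrite /admissible /= => r0; rewrite -(@ler_pXn2r _ 2) ?nnegrE ?tau2_ge0 // sqrtCK.
  exact: circle_tau2_bound.
case: (dist_core oddK psiP psi_n largeC B0 leB) => [|core]; [by left | right].
have e0 : 0 < #|E|%:R :> algC.
  rewrite ltr0n lt0n; apply/eqP => e0; move: large; rewrite e0 mul0n leqn0 muln_eq0 /=.
  by rewrite expn_eq0 andbT; case: #|K| (ltnW (finNzRing_gt1 K)).
rewrite -(ler_nat algC) -(ler_pM2l (exprn_gt0 3 e0)).
have : (#|E|%:R * (#|E|%:R * #|F|%:R)) ^+ 2 <= (4 * D%:R * B) ^+ 2.
  by rewrite lerXn2r // nnegrE ?mulr_ge0 ?ler0n.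
have -> : (#|E|%:R * (#|E|%:R * #|F|%:R)) ^+ 2 = #|E|%:R ^+ 3 * (#|E| * #|F| ^ 2)%:R :> algC.
  by rewrite natrM natrX; ring.
suff -> : (4 * D%:R * B) ^+ 2 = #|E|%:R ^+ 3 * (48 * (D ^ 2 * #|K| ^ 2))%:R by [].
by rewrite exprMn sqrtCK !natrM; ring.
Qed.
End NatBounds.

Local Close Scope ring_scope.

(** * The theorem over the reals *)

From Stdlib Require Import Reals Lra.

Local Open Scope R_scope.

Lemma INR_muln (m n : nat) : INR (muln m n) = INR m * INR n.
Proof. exact: mult_INR. Qed.

Lemma INR_expn (m k : nat) : INR (expn m k) = INR m ^ k.
Proof. by elim: k => [|k IH] //; rewrite expnS INR_muln IH. Qed.

Lemma INR_leq (m n : nat) : leq m n <-> INR m <= INR n.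
Proof. by split=> [/ssrnat.leP/le_INR|/INR_le/ssrnat.leP]. Qed.

Lemma INR_lit (n : nat) (z : Z) : Z.of_nat n = z -> INR n = IZR z.
Proof. by move=> <-; rewrite INR_IZR_INZ. Qed.

Theorem theorem1 :
  forall s : nat, (2 <= s)%nat ->
  exists c : R, 0 < c /\
  forall (K : finFieldType), odd #|K| ->
  forall E F : {set 'rV[K]_s},
    (#|E| <= #|F|)%nat ->
    INR #|E| * INR #|F| >= (900 + ln (INR #|K|)) * INR #|K| ^ s ->
    INR #|dist_set E F| >=
      c * Rmin (INR #|K|)
               (INR #|F| / (Rpower (INR #|K|) ((INR s - 1) / 2) * ln (INR #|K|)))
    /\
    (s = 2%nat ->
     INR #|dist_set E F| >=
       c * Rmin (INR #|K|)
                (sqrt (INR #|E|) * INR #|F| / (INR #|K| * ln (INR #|K|)))).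
Proof.
(* The value [16] is the square root of [256]; it also dominates [8] and the square root of [48]. *)
move=> s s2; exists (/ 16); split; first lra.
move=> K oddK E F _ large.
have q3 : 3 <= INR #|K|.
  have /INR_leq := card_finField_odd_ge3 oddK; rewrite (@INR_lit 3 3 erefl) //.
(* Since [exp 1 <= 3 <= q], dividing by the logarithm only weakens a lower bound. *)
have lnq1 : 1 <= ln (INR #|K|).
  apply: Rnot_lt_le => /exp_increasing; rewrite exp_ln; last lra.
  by have := exp_le_3; lra.
have large_nat : leq (muln 900 (expn #|K| s)) (muln #|E| #|F|).
  apply/INR_leq; rewrite !INR_muln INR_expn (@INR_lit 900 900 erefl) //.
  have : 0 < INR #|K| ^ s by apply: pow_lt; lra.
  nra.
have reduce (Y P : R) : 0 < P ->
    leq #|K| (muln 8 #|dist_set E F|) \/ Y <= 16 * INR #|dist_set E F| * P ->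
    INR #|dist_set E F| >= / 16 * Rmin (INR #|K|) (Y / (P * ln (INR #|K|))).
  have D0 : 0 <= INR #|dist_set E F| by apply: pos_INR.
  move=> P0 [/INR_leq|YP].
    rewrite INR_muln (@INR_lit 8 8 erefl) // => qD.
    by have := Rmin_l (INR #|K|) (Y / (P * ln (INR #|K|))); lra.
  have Pl : 0 < P * ln (INR #|K|) by apply: Rmult_lt_0_compat; lra.
  suff : Y / (P * ln (INR #|K|)) <= 16 * INR #|dist_set E F|.
    by have := Rmin_r (INR #|K|) (Y / (P * ln (INR #|K|))); lra.
  apply: (Rmult_le_reg_r _ _ _ Pl); rewrite /Rdiv Rmult_assoc Rinv_l; last lra.
  have : 0 <= INR #|dist_set E F| * P by apply: Rmult_le_pos; lra.
  nra.
have le_of_sqr (a b : R) : 0 <= b -> a ^ 2 <= b ^ 2 -> a <= b by move=> b0 ab; nra.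
split.
  apply: reduce; first exact: exp_pos.
  case: s s2 E F large large_nat => [//|s] _ E F _ large_nat.
  have [|/INR_leq H] := dist_set_lower_nat oddK large_nat; [by left | right].
  have D0 : 0 <= INR #|dist_set E F| by apply: pos_INR.
  move: H; rewrite !INR_muln !INR_expn (@INR_lit 256 256 erefl) //.
  set p := Rpower _ _; have p0 : 0 < p by apply: exp_pos.
  have -> : INR #|K| ^ s = p ^ 2.
    rewrite -Rpower_pow; last lra.
    have -> : p ^ 2 = p * p by rewrite /= Rmult_1_r.
    by rewrite -Rpower_plus S_INR; congr Rpower; lra.
  move=> H; apply: le_of_sqr; last by move: H; rewrite /=; lra.
  by apply: Rmult_le_pos; [apply: Rmult_le_pos|]; lra.
(* The sets depend on [s], so the equality is eliminated in their type. *)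
move=> s_eq2; case: _ / (esym s_eq2) E F large large_nat reduce => E F _ large_nat reduce.
apply: reduce; first lra.
have [|/INR_leq H] := dist_set_lower_nat2 oddK large_nat; [by left | right].
move: H; rewrite !INR_muln ?INR_expn (@INR_lit 48 48 erefl) => H.
have D0 : 0 <= INR #|dist_set E F| by apply: pos_INR.
have E0 : 0 <= INR #|E| by apply: pos_INR.
apply: le_of_sqr; first by apply: Rmult_le_pos; [apply: Rmult_le_pos|]; lra.
rewrite Rpow_mult_distr -Rsqr_pow2 Rsqr_sqrt //.
have : 0 <= (INR #|dist_set E F| * INR #|K|) ^ 2 by apply: pow2_ge_0.
by move: H; rewrite !Rpow_mult_distr /=; lra.
Qed.
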